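(* Let $1/2<p<\infty$ and let $\psi$ be a function of bounded variation on $\mathbb{R}$. Then the function $(x,y)\mapsto\psi(\max\{x,y\})$ on $\mathbb{R}^2$ is a Schur multiplier of $\boldsymbol{S}_p$.
   Context: $\boldsymbol{S}_p$, $0<p<\infty$, is the Schatten--von Neumann class: bounded operators $T$ with $\sum_{n\ge0}s_n(T)^p<\infty$, where $s_n(T)=\inf\{\|T-R\|:\operatorname{rank}R\le n\}$. For $0<p\le2$, a function $\omega$ on $\mathbb{R}^2$ is called a Schur multiplier of $\boldsymbol{S}_p$ if the integral operator on $L^2(\mathbb{R})$ with kernel function $\omega k$ belongs to $\boldsymbol{S}_p$ whenever the integral operator on $L^2(\mathbb{R})$ with kernel function $k$ does. For $2<p<\infty$ the notion is defined by duality: $\omega$ is a Schur multiplier of $\boldsymbol{S}_p$ if it is a Schur multiplier of $\boldsymbol{S}_{p'}$, where $p'=p/(p-1)$. *)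

(* Defs.v *)
From HB Require Import structures.
From mathcomp Require Import all_boot all_order all_algebra.
From mathcomp Require Import complex.
From mathcomp Require Import all_classical all_reals all_analysis.
Set Implicit Arguments.
Unset Strict Implicit.
Unset Printing Implicit Defensive.
Import Order.TTheory GRing.Theory Num.Theory.
Import numFieldNormedType.Exports.
Local Open Scope classical_set_scope.
Local Open Scope ring_scope.

(* The operators act on the complex Hilbert space L^2(R), with Lebesgue
   measure on the real line.  An element of L^2(R) is represented by a
   square-integrable Borel function R -> R[i]; equality in L^2(R) is equality
   almost everywhere. *)

(* The modulus as an element of R; the generic norm `|z| is an element of
   R[i]. *)
Definition cmod (R : realType) (z : R[i]) : R := ComplexField.Normc.normc z.

Definition cmeasurable d (T : measurableType d) (R : realType)
    (f : T -> R[i]) : Prop :=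
  measurable_fun setT (fun x => complex.Re (f x)) /\
  measurable_fun setT (fun x => complex.Im (f x)).

Definition cintegrable (R : realType) (f : R -> R[i]) : Prop :=
  (@lebesgue_measure R).-integrable setT (fun x => (complex.Re (f x))%:E) /\
  (@lebesgue_measure R).-integrable setT (fun x => (complex.Im (f x))%:E).

Definition cintegral (R : realType) (f : R -> R[i]) : R[i] :=
  Complex (Rintegral (@lebesgue_measure R) setT (fun x => complex.Re (f x)))
          (Rintegral (@lebesgue_measure R) setT (fun x => complex.Im (f x))).

Definition L2norm (R : realType) (f : R -> R[i]) : \bar R :=
  Lnorm (@lebesgue_measure R) 2%:E (fun x => (cmod (f x))%:E).

Definition L2 (R : realType) (f : R -> R[i]) : Prop :=
  cmeasurable f /\ (L2norm f < +oo)%E.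

Definition opnorm (R : realType) (T : (R -> R[i]) -> (R -> R[i])) : \bar R :=
  ereal_sup [set L2norm (T f) | f in [set f | L2 f /\ (L2norm f <= 1)%E]].

(* Linearity (modulo null functions) and boundedness force T to send functions
   equal almost everywhere to functions equal almost everywhere, so that T
   induces an operator on L^2(R).  The values of T outside L^2(R) are
   irrelevant. *)
Definition bounded_operator (R : realType)
    (T : (R -> R[i]) -> (R -> R[i])) : Prop :=
  [/\ forall f, L2 f -> L2 (T f),
      forall (c : R[i]) f g, L2 f -> L2 g ->
        {ae @lebesgue_measure R, forall x,
          T (fun t => c * f t + g t) x = c * T f x + T g x}
    & (opnorm T < +oo)%E].

(* The range of T is contained in the span of n elements of L^2(R). *)
Definition rank_le (R : realType) (n : nat)
    (T : (R -> R[i]) -> (R -> R[i])) : Prop :=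
  exists g : 'I_n -> R -> R[i],
    (forall i, L2 (g i)) /\
    forall f, L2 f -> exists c : 'I_n -> R[i],
      {ae @lebesgue_measure R, forall x, T f x = \sum_(i < n) c i * g i x}.

Definition singular_number (R : realType) (n : nat)
    (T : (R -> R[i]) -> (R -> R[i])) : \bar R :=
  ereal_inf [set opnorm (fun f x => T f x - S f x)
    | S in [set S | bounded_operator S /\ rank_le n S]].

Definition schatten (R : realType) (p : R)
    (T : (R -> R[i]) -> (R -> R[i])) : Prop :=
  bounded_operator T /\
  (\sum_(0 <= n <oo) poweR (singular_number n T) p < +oo)%E.

Definition kernel_operator (R : realType) (k : R * R -> R[i])
    (f : R -> R[i]) (x : R) : R[i] :=
  cintegral (fun y => k (x, y) * f y).

(* "The integral operator with kernel k belongs to S_p", where k is not assumed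
   to be square-integrable.  The middle clause says that the integral defining
   the operator converges absolutely; without it Rintegral would return a
   default value. *)
Definition kernel_in_schatten (R : realType) (p : R)
    (k : R * R -> R[i]) : Prop :=
  [/\ cmeasurable k,
      forall f, L2 f ->
        {ae @lebesgue_measure R, forall x,
          cintegrable (fun y => k (x, y) * f y)}
    & schatten p (kernel_operator k)].

Definition schur_multiplier_le2 (R : realType) (p : R)
    (omega : R * R -> R[i]) : Prop :=
  forall k : R * R -> R[i], kernel_in_schatten p k ->
    kernel_in_schatten p (fun z => omega z * k z).

(* Meaningful for 0 < p. *)
Definition schur_multiplier (R : realType) (p : R)
    (omega : R * R -> R[i]) : Prop :=
  if p <= 2 then schur_multiplier_le2 p omega
  else schur_multiplier_le2 (p / (p - 1)) omega.

(* The library's bounded_variation is for real-valued functions on a compact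
   interval; here the values are complex and the bound M is uniform over all
   finite partitions a < s_0 < ... < s_m = b of all intervals [a, b]. *)
Definition bounded_variation_line (R : realType) (psi : R -> R[i]) : Prop :=
  exists M : R, forall (a b : R) (s : seq R), itv_partition a b s ->
    \sum_(0 <= n < size s)
      cmod (psi (nth b (a :: s) n.+1) - psi (nth b (a :: s) n)) <= M.

(* Main.v *)
From HB Require Import structures.
Require Import Defs.
From mathcomp Require Import all_boot all_order all_algebra.
From mathcomp Require Import complex.
From mathcomp Require Import all_classical all_reals all_analysis measurable_realfun.
From mathcomp Require Import zify ring lra.
Set Implicit Arguments.
Unset Strict Implicit.
Unset Printing Implicit Defensive.
Import Order.TTheory GRing.Theory Num.Theory.
Import numFieldNormedType.Exports.
Local Open Scope classical_set_scope.
Local Open Scope ring_scope.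
Local Open Scope complex_scope.

(** Multiplying a kernel by a function of the larger variable is transparent
    when the function is the indicator of an initial segment L of the line:
    max(x, y) lies in L exactly when both x and y do, so the operator T becomes
    P T P with P the multiplication by the indicator of L.  A function psi of
    bounded variation is a uniform limit of combinations sum_t c_t 1_{L_t} with
    sum_t |c_t| bounded [bounded_variation_stepwise].  For such a step function
    the multiplier is T |-> sum_t c_t P_t T P_t [chain_mult], where the P_t form
    an increasing chain of projections; it acts on all bounded operators with
    norm at most M = sum_t |c_t|.  The task is a bound on singular numbers that
    depends on the step function only through M.

    The heart is the estimate for an operator of rank N and norm a: its
    multiplier is within M a / n^2 of rank 8 n N [approx_chain_mult_tensor].
    For a rank one operator f |-> <f, v> u, the numbers |P_t u|^2 and |P_t v|^2
    increase along the chain, so they are constant up to 1/n on each of about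
    2 n pieces of the chain.  Writing P_t = Q_t + S_t with Q_t constant on every
    piece, the terms containing Q_t contribute rank O(n), and the remaining
    operator sum_t c_t <., S_t v> S_t u has nuclear norm at most M a / n
    [chain_mult_rank1].  For rank N the nuclear norms add up to M a N / n, and
    an operator of nuclear norm W is within W / m of rank 2 m [approx_nuclear];
    the choice m = n N gains the second factor 1 / n.

    An operator T in S_p is a sum of dyadic pieces of rank about 2^k and norm
    about s_{2^k}(T).  Spending n = x^{m-k} on piece k, with x < 2, costs a
    total rank O(2^m) and bounds s_{C 2^m} of the multiplier of T by a multiple
    of sum_{k <= m} s_{2^k}(T) x^{-2(m-k)} [approx_chain_mult].  The sums of
    2^m times the p-th powers of these quantities converge as soon as
    2 x^{-2p} < 1, and some x < 2 satisfies this exactly when p > 1/2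
    [powR_summable_transfer].  For p > 2 the conjugate exponent exceeds 1, so
    the same argument applies to it.

    For a kernel operator, the multipliers with step symbols converge almost
    everywhere to the operator with the weighted kernel, and they form a Cauchy
    sequence in operator norm because T is a norm limit of operators of finite
    rank; Fatou's lemma then makes the convergence a convergence in norm
    [step_multiplier_norm_close].

    The operator theory takes place in a semi-inner product space, possibly
    incomplete, in which functions equal almost everywhere differ by a null
    vector.  Finite rank operators are explicit sums of rank one operators,
    obtained from a Gram-Schmidt basis of the range and from near-maximizers of
    functionals [finite_rank_tensor]. *)

(** * Complex numbers with a real-valued modulus *)

Section Modulus.
Variable R : realType.
Implicit Types z w : R[i].

Lemma cmodE z : cmod z = Num.sqrt ((complex.Re z) ^+ 2 + (complex.Im z) ^+ 2).
Proof. by case: z. Qed.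

Lemma cmod_ge0 z : 0 <= cmod z.
Proof. by rewrite cmodE sqrtr_ge0. Qed.

Lemma cmod0 : cmod (0 : R[i]) = 0.
Proof. exact: ComplexField.Normc.normc0. Qed.

Lemma cmod1 : cmod (1 : R[i]) = 1.
Proof. exact: ComplexField.Normc.normc1. Qed.

Lemma cmodM z w : cmod (z * w) = cmod z * cmod w.
Proof. exact: ComplexField.Normc.normcM. Qed.

Lemma cmodD z w : cmod (z + w) <= cmod z + cmod w.
Proof. exact: le_normcD. Qed.

Lemma cmodN z : cmod (- z) = cmod z.
Proof. exact: normcN. Qed.

Lemma cmod_eq0 z : cmod z = 0 -> z = 0.
Proof. exact: ComplexField.Normc.eq0_normc. Qed.

Lemma cmodJ z : cmod z^*%C = cmod z.
Proof. by case: z => a b; rewrite !cmodE /= sqrrN. Qed.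

Lemma cmodR (x : R) : cmod x%:C = `|x|.
Proof. by rewrite cmodE /= expr0n addr0 sqrtr_sqr. Qed.

Lemma sqr_cmod z : cmod z ^+ 2 = (complex.Re z) ^+ 2 + (complex.Im z) ^+ 2.
Proof. by rewrite cmodE sqr_sqrtr // addr_ge0 ?sqr_ge0. Qed.

Lemma mulJc z : z * z^*%C = (cmod z ^+ 2)%:C.
Proof.
case: z => a b; rewrite sqr_cmod /=; apply/eqP; rewrite eq_complex /=.
by apply/andP; split; apply/eqP; ring.
Qed.

Lemma norm_Re_le_cmod z : `|complex.Re z| <= cmod z.
Proof.
by rewrite cmodE -sqrtr_sqr ler_sqrt ?lerDl ?sqr_ge0// addr_ge0 ?sqr_ge0.
Qed.

Lemma Re_le_cmod z : complex.Re z <= cmod z.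
Proof. by rewrite (le_trans (ler_norm _))// norm_Re_le_cmod. Qed.

Lemma Im_le_cmod z : `|complex.Im z| <= cmod z.
Proof.
by rewrite cmodE -sqrtr_sqr ler_sqrt ?lerDr ?sqr_ge0// addr_ge0 ?sqr_ge0.
Qed.

Lemma cmod_le_ReIm z : cmod z <= `|complex.Re z| + `|complex.Im z|.
Proof.
rewrite -ler_sqr ?nnegrE ?cmod_ge0 ?addr_ge0// sqr_cmod sqrrD.
by rewrite !real_normK ?num_real// lerD2r lerDl mulrn_wge0// mulr_ge0.
Qed.

Lemma cmod_sum (I : Type) (r : seq I) (F : I -> R[i]) :
  cmod (\sum_(i <- r) F i) <= \sum_(i <- r) cmod (F i).
Proof.
elim: r => [|i r IH]; first by rewrite !big_nil cmod0.
by rewrite !big_cons (le_trans (cmodD _ _))// lerD2l.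
Qed.

Lemma ReD z w : complex.Re (z + w) = complex.Re z + complex.Re w.
Proof. by case: z w => [a b] [c d]. Qed.

Lemma ImD z w : complex.Im (z + w) = complex.Im z + complex.Im w.
Proof. by case: z w => [a b] [c d]. Qed.

Lemma ReN z : complex.Re (- z) = - complex.Re z.
Proof. by case: z. Qed.

Lemma ImN z : complex.Im (- z) = - complex.Im z.
Proof. by case: z. Qed.

Lemma ReM z w : complex.Re (z * w) =
  complex.Re z * complex.Re w - complex.Im z * complex.Im w.
Proof. by case: z w => [a b] [c d]. Qed.

Lemma ImM z w : complex.Im (z * w) =
  complex.Re z * complex.Im w + complex.Im z * complex.Re w.
Proof. by case: z w => [a b] [c d]. Qed.

End Modulus.

(** * Semi-inner product spaces *)

Section SemiInner.
Variables (R : realType) (V : lmodType R[i]).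

Definition semi_inner (dot : V -> V -> R[i]) : Prop :=
  [/\ forall a x y z, dot (a *: x + y) z = a * dot x z + dot y z,
      forall x y, dot y x = (dot x y)^*%C
    & forall x, 0 <= complex.Re (dot x x)].

Variable dot : V -> V -> R[i].
Hypothesis dotP : semi_inner dot.

Definition nsq x : R := complex.Re (dot x x).
Definition nrm x : R := Num.sqrt (nsq x).

Lemma dotDl x y z : dot (x + y) z = dot x z + dot y z.
Proof. by case: dotP => h _ _; rewrite -[x]scale1r h mul1r scale1r. Qed.

Lemma dot0l z : dot 0 z = 0.
Proof. by apply: (addrI (dot 0 z)); rewrite -dotDl !addr0. Qed.

Lemma dotZl a x z : dot (a *: x) z = a * dot x z.
Proof. by case: dotP => h _ _; rewrite -[a *: x]addr0 h dot0l addr0. Qed.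

Lemma dotC x y : dot y x = (dot x y)^*%C.
Proof. by case: dotP => _ h _; exact: h. Qed.

Lemma dotDr x y z : dot z (x + y) = dot z x + dot z y.
Proof. by rewrite dotC dotDl rmorphD /= -!dotC. Qed.

Lemma dotZr a x z : dot z (a *: x) = a^*%C * dot z x.
Proof. by rewrite dotC dotZl rmorphM /= -dotC. Qed.

Lemma dot0r z : dot z 0 = 0.
Proof. by rewrite dotC dot0l rmorph0. Qed.

Lemma dotNl x z : dot (- x) z = - dot x z.
Proof. by rewrite -scaleN1r dotZl mulN1r. Qed.

Lemma dotNr x z : dot z (- x) = - dot z x.
Proof. by rewrite dotC dotNl rmorphN /= -dotC. Qed.

Lemma dotBl x y z : dot (x - y) z = dot x z - dot y z.
Proof. by rewrite dotDl dotNl. Qed.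

Lemma dot_suml (I : Type) (r : seq I) (Q : pred I) (F : I -> V) z :
  dot (\sum_(i <- r | Q i) F i) z = \sum_(i <- r | Q i) dot (F i) z.
Proof. exact: (big_morph (dot^~ z) (fun x y => dotDl x y z) (dot0l z)). Qed.

Lemma dot_sumr (I : Type) (r : seq I) (Q : pred I) (F : I -> V) z :
  dot z (\sum_(i <- r | Q i) F i) = \sum_(i <- r | Q i) dot z (F i).
Proof. exact: (big_morph (dot z) (fun x y => dotDr x y z) (dot0r z)). Qed.

Lemma nsq_ge0 x : 0 <= nsq x.
Proof. by case: dotP => _ _ h; exact: h. Qed.

Lemma dotxx x : dot x x = (nsq x)%:C.
Proof.
have := dotC x x; rewrite /nsq; case: (dot x x) => a b [] /= hb.
by apply/eqP; rewrite eq_complex /= eqxx /=; apply/eqP; lra.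
Qed.

Lemma nrm_ge0 x : 0 <= nrm x.
Proof. exact: sqrtr_ge0. Qed.

Lemma sqr_nrm x : nrm x ^+ 2 = nsq x.
Proof. by rewrite sqr_sqrtr ?nsq_ge0. Qed.

Lemma nsqZ a x : nsq (a *: x) = cmod a ^+ 2 * nsq x.
Proof.
rewrite /nsq dotZl dotZr mulrA mulJc dotxx /= ; ring.
Qed.

Lemma nrmZ a x : nrm (a *: x) = cmod a * nrm x.
Proof.
by rewrite /nrm nsqZ sqrtrM ?sqr_ge0// sqrtr_sqr ger0_norm ?cmod_ge0.
Qed.

Lemma nrmN x : nrm (- x) = nrm x.
Proof. by rewrite -scaleN1r nrmZ cmodN cmod1 mul1r. Qed.

Lemma nrm0 : nrm 0 = 0.
Proof. by rewrite /nrm /nsq dot0l sqrtr0. Qed.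

Lemma nsqD x y : nsq (x + y) = nsq x + nsq y + 2 * complex.Re (dot x y).
Proof.
rewrite /nsq dotDl !dotDr (dotC x y) !ReD.
by case: (dot x y) => a b /=; ring.
Qed.

Lemma nsqD_orth x y : dot x y = 0 -> nsq (x + y) = nsq x + nsq y.
Proof. by move=> h; rewrite nsqD h /= mulr0 addr0. Qed.

Lemma cauchy_schwarz x y : cmod (dot x y) <= nrm x * nrm y.
Proof.
(* the discriminant argument, run separately when the form degenerates at y *)
have key a : 0 <= nsq x - 2 * complex.Re (a^*%C * dot x y) + cmod a ^+ 2 * nsq y.
  have := nsq_ge0 (x - a *: y).
  rewrite nsqD -scaleNr nsqZ cmodN dotZr rmorphN /= mulNr ReN; lra.
rewrite -ler_sqr ?nnegrE ?mulr_ge0 ?cmod_ge0 ?nrm_ge0// exprMn !sqr_nrm.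
have conjd a : complex.Re ((a%:C * dot x y)^*%C * dot x y) = a * cmod (dot x y) ^+ 2.
  rewrite sqr_cmod; case: (dot x y) => u v /=; ring.
have [y0|yn0] := eqVneq (nsq y) 0.
  rewrite y0 mulr0 real_leNgt ?num_real//; apply/negP => d0.
  have := key (((nsq x + 1) / cmod (dot x y) ^+ 2)%:C * dot x y).
  by rewrite y0 conjd divfK ?gt_eqF// mulr0; have := nsq_ge0 x; lra.
have y0 : 0 < nsq y by rewrite lt_neqAle eq_sym yn0 nsq_ge0.
have := key ((nsq y)^-1%:C * dot x y).
rewrite conjd cmodM cmodR ger0_norm ?invr_ge0 ?nsq_ge0// exprMn => h.
have {}h : 0 <= (nsq x - cmod (dot x y) ^+ 2 / nsq y).
  apply: le_trans h _; rewrite le_eqVlt; apply/orP; left; apply/eqP.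
  by field.
by move: h; rewrite subr_ge0 ler_pdivrMr.
Qed.

Lemma nrmD x y : nrm (x + y) <= nrm x + nrm y.
Proof.
rewrite -ler_sqr ?nnegrE ?addr_ge0 ?nrm_ge0// sqr_nrm nsqD -!sqr_nrm.
by have := Re_le_cmod (dot x y); have := cauchy_schwarz x y; lra.
Qed.

Lemma nrmB x y : nrm (x - y) <= nrm x + nrm y.
Proof. by rewrite -(nrmN y) nrmD. Qed.

Lemma nrm_sum (I : Type) (r : seq I) (F : I -> V) :
  nrm (\sum_(i <- r) F i) <= \sum_(i <- r) nrm (F i).
Proof.
elim: r => [|i r IH]; first by rewrite !big_nil nrm0.
by rewrite !big_cons (le_trans (nrmD _ _))// lerD2l.
Qed.

Lemma nrm_null x y : nrm (x - y) = 0 -> nrm x = nrm y.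
Proof.
move=> h; apply/eqP; rewrite eq_le; apply/andP; split.
  by rewrite -[x](subrK y) (le_trans (nrmD _ _))// h add0r.
by rewrite -[y](subrK x) (le_trans (nrmD _ _))// -opprB nrmN h add0r.
Qed.

Lemma dot_null x y : nrm x = 0 -> dot x y = 0.
Proof.
move=> h; apply: cmod_eq0; apply/eqP; rewrite eq_le cmod_ge0 andbT.
by rewrite (le_trans (cauchy_schwarz _ _))// h mul0r.
Qed.

(** ** Orthonormal sequences *)

Fixpoint orthonormal (s : seq V) : Prop :=
  if s is x :: s' then
    [/\ dot x x = 1, {in s', forall y, dot x y = 0} & orthonormal s']
  else True.

Definition proj (s : seq V) (x : V) : V := \sum_(e <- s) dot x e *: e.

Lemma proj_orth s x : orthonormal s -> {in s, forall e, dot (x - proj s x) e = 0}.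
Proof.
elim: s x => [//|a s IH] x /= [aa as0 on] e.
have a0 y : dot (proj s y) a = 0.
  rewrite /proj dot_suml big_seq big1// => f fs.
  by rewrite dotZl (dotC a) as0// rmorph0 mulr0.
rewrite /proj big_cons -/(proj s x) inE => /predU1P[->|es].
  by rewrite dotBl dotDl dotZl aa a0; ring.
by rewrite opprD addrCA dotDl dotNl dotZl as0// mulr0 oppr0 add0r IH.
Qed.

Lemma nsq_proj s x : orthonormal s ->
  nsq (proj s x) = \sum_(e <- s) cmod (dot x e) ^+ 2.
Proof.
elim: s => [|a s IH] /=; first by rewrite /proj !big_nil /nsq dot0l.
move=> [aa as0 on]; rewrite /proj !big_cons -/(proj s x) nsqD_orth ?IH//.
  by rewrite nsqZ /nsq aa /= mulr1.
rewrite dotZl dot_sumr big_seq big1 ?mulr0// => f fs.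
by rewrite dotZr as0// mulr0.
Qed.

Lemma pythagoras s x : orthonormal s ->
  nsq x = nsq (x - proj s x) + \sum_(e <- s) cmod (dot x e) ^+ 2.
Proof.
move=> on; rewrite -nsq_proj// -nsqD_orth ?subrK//.
rewrite {2}/proj dot_sumr big_seq big1// => e es.
by rewrite dotZr proj_orth// mulr0.
Qed.

Lemma bessel s x : orthonormal s -> \sum_(e <- s) cmod (dot x e) ^+ 2 <= nsq x.
Proof. by move=> on; rewrite (pythagoras x on) lerDr nsq_ge0. Qed.

Lemma nrm_subproj s x : orthonormal s -> nrm (x - proj s x) <= nrm x.
Proof.
move=> on; rewrite ler_sqrt ?nsq_ge0// [leRHS](pythagoras x on) lerDl.
by apply: sumr_ge0 => e _; rewrite sqr_ge0.
Qed.

Lemma orthonormal_unit s e : orthonormal s -> e \in s -> nrm e = 1.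
Proof.
elim: s => // a s IH [aa _ on]; rewrite inE => /predU1P[->|]; last exact: IH.
by rewrite /nrm /nsq aa sqrtr1.
Qed.

Lemma projD s x y : proj s (x + y) = proj s x + proj s y.
Proof.
by rewrite /proj -big_split /=; apply: eq_bigr => e _; rewrite dotDl scalerDl.
Qed.

Lemma projZ s a x : proj s (a *: x) = a *: proj s x.
Proof.
by rewrite /proj scaler_sumr; apply: eq_bigr => e _; rewrite dotZl scalerA.
Qed.

Lemma proj0 s : proj s 0 = 0.
Proof. by rewrite /proj big1// => e _; rewrite dot0l scale0r. Qed.

Lemma proj_cons_null a s x : orthonormal (a :: s) ->
  nrm (x - proj s x) = 0 -> nrm (x - proj (a :: s) x) = 0.
Proof.
move=> /= [aa as0 on] h; have xa : dot x a = 0.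
  rewrite -[x](subrK (proj s x)) dotDl dot_null// add0r /proj dot_suml big_seq.
  by rewrite big1// => f fs; rewrite dotZl (dotC a) as0// rmorph0 mulr0.
by rewrite /proj big_cons xa scale0r add0r.
Qed.

(** A vector whose component orthogonal to its predecessors is null is dropped,
    hence the conclusion modulo null vectors. *)
Lemma gram_schmidt (g : seq V) : exists s : seq V,
  [/\ orthonormal s, (size s <= size g)%N
    & {in g, forall x, nrm (x - proj s x) = 0}].
Proof.
elim: g => [|x g [s [on sg hs]]]; first by exists [::].
set w := x - proj s x.
have [w0|wn0] := eqVneq (nrm w) 0.
  exists s; split => //=; first exact: leqW.
  by move=> y; rewrite inE => /predU1P[->//|]; exact: hs.
set a := (nrm w)^-1%:C *: w.
have aa : dot a a = 1.
  rewrite dotxx nsqZ cmodR ger0_norm ?invr_ge0 ?nrm_ge0// -sqr_nrm.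
  by rewrite -exprMn mulVf// expr1n.
have ona : orthonormal (a :: s).
  by split=> // y ys; rewrite dotZl proj_orth// mulr0.
exists (a :: s); split => // y; rewrite inE => /predU1P[->|yg].
  rewrite /proj big_cons -/(proj s x) opprD addrCA -/w.
  have -> : dot x a = (nrm w)%:C.
    rewrite -[x](subrK (proj s x)) dotDl -/w /proj dot_suml big_seq.
    rewrite big1 ?addr0.
      rewrite /a dotZr dotxx -sqr_nrm conjc_real -rmorphM expr2 mulrA.
      by rewrite mulVf// mul1r.
    move=> e es; rewrite dotZl /a dotZr [dot e w]dotC proj_orth// rmorph0.
    by rewrite !mulr0.
  by rewrite /a scalerA -rmorphM divff// scale1r addNr nrm0.
by apply: proj_cons_null => //; exact: hs.
Qed.

End SemiInner.

(** * Operators near finite rank *)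

Section FiniteRank.
Variables (R : realType) (V : lmodType R[i]) (dot : V -> V -> R[i]).
Hypothesis dotP : semi_inner dot.
Local Notation nrm := (nrm dot).
Local Notation nsq := (nsq dot).
Local Notation proj := (proj dot).
Local Notation orthonormal := (orthonormal dot).

Definition ftens (s : seq (V * V)) (f : V) : V :=
  \sum_(p <- s) dot f p.2 *: p.1.

(** A form of s_m(T) <= sg in which the approximant is an explicit sum of at
    most m rank one operators, whatever the nature of T. *)
Definition approx (m : nat) (sg : R) (T : V -> V) : Prop :=
  exists2 s : seq (V * V), (size s <= m)%N &
    forall f, nrm (T f - ftens s f) <= sg * nrm f.

Lemma ftens_cat s t f : ftens (s ++ t) f = ftens s f + ftens t f.
Proof. by rewrite /ftens big_cat. Qed.

Lemma approx_le m m' sg sg' T : (m <= m')%N -> sg <= sg' ->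
  approx m sg T -> approx m' sg' T.
Proof.
move=> mm ss [s sm h]; exists s; first exact: leq_trans mm.
by move=> f; rewrite (le_trans (h f))// ler_wpM2r ?nrm_ge0.
Qed.

Lemma approxD m m' sg sg' T T' : approx m sg T -> approx m' sg' T' ->
  approx (m + m') (sg + sg') (fun f => T f + T' f).
Proof.
move=> [s sm h] [s' sm' h']; exists (s ++ s'); first by rewrite size_cat leq_add.
move=> f; rewrite ftens_cat opprD addrACA mulrDl.
by rewrite (le_trans (nrmD dotP _ _))// lerD.
Qed.

Lemma approx_eq m sg T T' : (forall f, nrm (T f - T' f) = 0) ->
  approx m sg T -> approx m sg T'.
Proof.
move=> TT [s sm h]; exists s => // f; rewrite (le_trans _ (h f))// le_eqVlt.
apply/orP; left; apply/eqP/esym/(nrm_null dotP).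
by rewrite opprD opprK addrACA addNr addr0.
Qed.

Lemma approx0 sg T : (forall f, nrm (T f) <= sg * nrm f) -> approx 0 sg T.
Proof. by move=> h; exists [::] => // f; rewrite /ftens big_nil subr0. Qed.

Lemma approx_sum (K : nat) (m : nat -> nat) (sg : nat -> R) (T : nat -> V -> V) :
  (forall k, (k < K)%N -> approx (m k) (sg k) (T k)) ->
  approx (\sum_(k < K) m k) (\sum_(k < K) sg k) (fun f => \sum_(k < K) T k f).
Proof.
elim: K => [|K IH] h.
  rewrite !big_ord0; apply: approx0 => f.
  by rewrite big_ord0 (nrm0 dotP) mul0r.
rewrite !big_ord_recr /=.
apply: (@approx_eq _ _ (fun f => \sum_(k < K) T k f + T K f)).
  by move=> f; rewrite big_ord_recr /= subrr (nrm0 dotP).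
apply: approxD; last exact: h.
by apply: IH => k kK; apply: h; exact: leqW.
Qed.

(** The Riesz theorem up to an error, valid in an incomplete space: a
    near-maximizer of a functional on the unit ball nearly represents it.  On
    the orthogonal complement of the maximizer the functional is small, since
    the squares of its values along orthonormal vectors add up to at most the
    square of its norm. *)
Lemma approx_riesz (phi : V -> R[i]) (a e : R) : 0 <= a -> 0 < e ->
  (forall c x y, phi (c *: x + y) = c * phi x + phi y) ->
  (forall f, cmod (phi f) <= a * nrm f) ->
  exists2 v, nrm v <= a & forall f, cmod (phi f - dot f v) <= e * nrm f.
Proof.
move=> a0 e0 lin bnd.
have phi0 : phi 0 = 0.
  apply: cmod_eq0; apply/eqP; rewrite eq_le cmod_ge0 andbT.
  by have := bnd 0; rewrite (nrm0 dotP) mulr0.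
have phiZ c x : phi (c *: x) = c * phi x by rewrite -[c *: x]addr0 lin phi0 addr0.
have phiD x y : phi (x + y) = phi x + phi y by rewrite -{1}[x]scale1r lin mul1r.
have phiN x : phi (- x) = - phi x by rewrite -scaleN1r phiZ mulN1r.
pose A := [set cmod (phi f) | f in [set f | nrm f <= 1]].
have A0 : A !=set0 by exists (cmod (phi 0)); exists 0 => //=; rewrite (nrm0 dotP).
have Aa : has_ubound A.
  exists a => _ [f /= f1 <-]; rewrite (le_trans (bnd f))//.
  by rewrite -[leRHS]mulr1 ler_wpM2l.
pose k := sup A.
have le_k f : cmod (phi f) <= k * nrm f.
  have [f0|fn0] := eqVneq (nrm f) 0.
    by rewrite f0 mulr0 (le_trans (bnd f))// f0 mulr0.
  have fp : 0 < nrm f by rewrite lt_neqAle eq_sym fn0 nrm_ge0.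
  rewrite -ler_pdivrMr//.
  have -> : cmod (phi f) / nrm f = cmod (phi ((nrm f)^-1%:C *: f)).
    by rewrite phiZ cmodM cmodR ger0_norm ?invr_ge0 ?nrm_ge0// mulrC.
  apply: ub_le_sup => //; exists ((nrm f)^-1%:C *: f) => //=.
  by rewrite (nrmZ dotP) cmodR ger0_norm ?invr_ge0 ?nrm_ge0// mulVf.
have [ke|ek] := leP k e.
  exists 0 => [|f]; first by rewrite (nrm0 dotP).
  by rewrite (dot0r dotP) subr0 (le_trans (le_k f))// ler_wpM2r ?nrm_ge0.
have k0 : 0 < k by exact: lt_trans ek.
pose d := e ^+ 2 / (2 * k).
have dp : 0 < d by rewrite divr_gt0 ?exprn_gt0 ?mulr_gt0.
have dk : d <= k / 2.
  rewrite /d ler_pdivrMr ?mulr_gt0// (_ : k / 2 * (2 * k) = k ^+ 2); last by field.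
  by rewrite ler_sqr ?nnegrE ?ltW.
have [_ [v0 /= v01 <-] kv] := sup_adherent dp (conj A0 Aa).
rewrite -/k in kv.
have pv0 : 0 < cmod (phi v0) by lra.
have nv0 : 0 < nrm v0.
  rewrite lt_neqAle nrm_ge0 andbT eq_sym; apply/eqP => h.
  by have := le_k v0; rewrite h mulr0; lra.
pose b := (nrm v0)^-1%:C *: v0.
have nb : nrm b = 1.
  by rewrite (nrmZ dotP) cmodR ger0_norm ?invr_ge0 ?nrm_ge0// mulVf ?gt_eqF.
have kb : k - d < cmod (phi b).
  rewrite (lt_le_trans kv)// phiZ cmodM cmodR ger0_norm ?invr_ge0 ?nrm_ge0//.
  by rewrite ler_peMl ?cmod_ge0// invf_ge1.
have bb : dot b b = 1 by rewrite (dotxx dotP) -(sqr_nrm dotP) nb expr1n.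
(* b nearly attains the norm k of phi: by the choice of d, the square of
   |phi b| exceeds k^2 - e^2, which leaves less than e for a unit vector
   orthogonal to b *)
clearbody b; exists ((phi b)^*%C *: b).
  by rewrite (nrmZ dotP) cmodJ nb mulr1 (le_trans (bnd b))// nb mulr1.
move=> f; pose w := f - dot f b *: b.
have -> : phi f - dot f ((phi b)^*%C *: b) = phi w.
  by rewrite (dotZr dotP) conjcK /w phiD phiN phiZ [phi b * _]mulrC.
have onb : orthonormal [:: b] by [].
have projb x : proj [:: b] x = dot x b *: b by rewrite /proj big_seq1.
have wb : dot w b = 0 by rewrite -(proj_orth dotP f onb (mem_head _ _)) projb.
have wf : nrm w <= nrm f by rewrite /w -projb (nrm_subproj dotP).
suff h : cmod (phi w) <= e * nrm w by rewrite (le_trans h)// ler_wpM2l// ltW.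
have [w0|wn0] := eqVneq (nrm w) 0.
  by rewrite w0 mulr0 (le_trans (bnd w))// w0 mulr0.
have wp : 0 < nrm w by rewrite lt_neqAle eq_sym wn0 nrm_ge0.
have [x [nx xb px]] : exists x, [/\ nrm x = 1, dot x b = 0
    & phi x = (nrm w)^-1%:C * phi w].
  exists ((nrm w)^-1%:C *: w); split => //; last by rewrite (dotZl dotP) wb mulr0.
  by rewrite (nrmZ dotP) cmodR ger0_norm ?invr_ge0 ?nrm_ge0// mulVf.
pose h := (phi x)^*%C *: x + (phi b)^*%C *: b.
pose t := cmod (phi x) ^+ 2 + cmod (phi b) ^+ 2.
have ph : phi h = t%:C.
  by rewrite lin (phiZ _ b) ![(phi _)^*%C * _]mulrC !mulJc -rmorphD.
have nh : nsq h = t.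
  rewrite (nsqD_orth dotP).
    by rewrite !(nsqZ dotP) !cmodJ -!(sqr_nrm dotP) nx nb expr1n !mulr1.
  by rewrite (dotZl dotP) (dotZr dotP) xb !mulr0.
have t0 : 0 <= t by rewrite addr_ge0 ?sqr_ge0.
have tk : t <= k ^+ 2.
  have := le_k h; rewrite ph cmodR ger0_norm// -nh -(sqr_nrm dotP) => n1.
  have n0 := nrm_ge0 dot h; rewrite ler_sqr ?nnegrE ?(ltW k0)//.
  have [->|hn0] := eqVneq (nrm h) 0; first exact: ltW.
  have hp : 0 < nrm h by rewrite lt_neqAle eq_sym hn0.
  by rewrite -(ler_pM2r hp) -expr2.
have xe : cmod (phi x) <= e.
  rewrite -ler_sqr ?nnegrE ?cmod_ge0 ?(ltW e0)//.
  have : (k - d) ^+ 2 <= cmod (phi b) ^+ 2.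
    by rewrite ler_sqr ?nnegrE ?cmod_ge0//; lra.
  have : 2 * k * d = e ^+ 2 by rewrite /d; field; rewrite gt_eqF.
  have := sqr_ge0 d.
  by rewrite /t in tk; move: tk; rewrite sqrrB; lra.
move: xe; rewrite px cmodM cmodR ger0_norm ?invr_ge0 ?nrm_ge0//.
by rewrite mulrC ler_pdivrMr.
Qed.

(** The vectors u form an orthonormal basis of the range and v represents
    f |-> <S f, u>; this gives norms at most 1 and a whatever spanning vectors
    g the range came with. *)
Lemma finite_rank_tensor (S : V -> V) (a e : R) (g : seq V) : 0 <= a -> 0 < e ->
  (forall c x y, nrm (S (c *: x + y) - (c *: S x + S y)) = 0) ->
  (forall f, nrm (S f) <= a * nrm f) ->
  (forall f, exists c : nat -> R[i],
     nrm (S f - \sum_(i < size g) c i *: g`_i) = 0) ->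
  exists s : seq (V * V),
    [/\ (size s <= size g)%N,
        {in s, forall p, nrm p.1 <= 1 /\ nrm p.2 <= a}
      & forall f, nrm (S f - ftens s f) <= e * nrm f].
Proof.
move=> a0 e0 lin bnd ran.
have [b [onb sb hb]] := gram_schmidt dotP g.
have Sproj f : nrm (S f - proj b (S f)) = 0.
  have [c hc] := ran f; set h := \sum_(i < _) _ in hc.
  have hp : nrm (h - proj b h) = 0.
    apply/eqP; rewrite eq_le nrm_ge0 andbT.
    rewrite {2}/h (big_morph (proj b) (projD dotP b) (proj0 dotP b)) -sumrB.
    rewrite (le_trans (nrm_sum dotP _ _))// big1// => i _.
    by rewrite (projZ dotP) -scalerBr (nrmZ dotP) hb ?mulr0// mem_nth.
  apply/eqP; rewrite eq_le nrm_ge0 andbT -hp.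
  have -> : S f = (S f - h) + h by rewrite subrK.
  rewrite (projD dotP) opprD addrACA (le_trans (nrmD dotP _ _))//.
  by rewrite gerDr -hc (nrm_subproj dotP).
pose e' := e / (size b).+1%:R.
have e'0 : 0 < e' by rewrite divr_gt0.
have /choice[v hv] u : exists v, u \in b -> nrm v <= a /\
    forall f, cmod (dot (S f) u - dot f v) <= e' * nrm f.
  have [ub|_] := boolP (u \in b); last by exists 0.
  have [||v va hv] := @approx_riesz (fun f => dot (S f) u) a e' a0 e'0.
  - move=> c x y; rewrite -(dotZl dotP) -(dotDl dotP); apply/eqP.
    by rewrite -subr_eq0 -(dotBl dotP) (dot_null dotP _ (lin c x y)) eqxx.
  - move=> f; rewrite (le_trans (cauchy_schwarz dotP _ _))//.
    by rewrite (orthonormal_unit onb ub) mulr1.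
  by exists v.
exists [seq (u, v u) | u <- b]; split.
- by rewrite size_map.
- by move=> _ /mapP[u ub ->] /=; have [? _] := hv _ ub;
    rewrite (orthonormal_unit onb ub).
move=> f; rewrite /ftens big_map /=.
rewrite -(@nrm_null _ _ _ dotP (proj b (S f) - \sum_(u <- b) dot f (v u) *: u)).
  rewrite -sumrB (le_trans (nrm_sum dotP _ _))//.
  rewrite (@le_trans _ _ (\sum_(u <- b) e' * nrm f))//.
    rewrite big_seq [leRHS]big_seq ler_sum// => u ub.
    rewrite -scalerBl (nrmZ dotP) (orthonormal_unit onb ub) mulr1.
    by have [_] := hv _ ub; exact.
  rewrite big_const_seq count_predT iter_addr_0.
  rewrite -mulr_natr mulrAC ler_wpM2r ?nrm_ge0// /e' mulrAC ler_pdivrMr//.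
  by rewrite ler_wpM2l ?ler_nat ?(ltW e0).
rewrite opprD opprK addrACA [- _ + _]addrC subrr addr0 -opprB.
by rewrite (nrmN dotP) Sproj.
Qed.

End FiniteRank.

(** * Nuclear operators and chains of projections *)

Lemma weighted_cauchy_schwarz (R : realType) (I : Type) (r : seq I) (w a b : I -> R) :
  (forall i, 0 <= w i) -> (forall i, 0 <= a i) -> (forall i, 0 <= b i) ->
  (\sum_(i <- r) w i * a i * b i) ^+ 2 <=
  (\sum_(i <- r) w i * a i ^+ 2) * (\sum_(i <- r) w i * b i ^+ 2).
Proof.
move=> w0 a0 b0; elim: r => [|i r]; first by rewrite !big_nil expr0n mul0r.
rewrite !big_cons.
have : 0 <= \sum_(j <- r) w j * a j * b j.
  by apply: sumr_ge0 => j _; rewrite !mulr_ge0.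
have : 0 <= \sum_(j <- r) w j * a j ^+ 2.
  by apply: sumr_ge0 => j _; rewrite !mulr_ge0// sqr_ge0.
have : 0 <= \sum_(j <- r) w j * b j ^+ 2.
  by apply: sumr_ge0 => j _; rewrite !mulr_ge0// sqr_ge0.
move: (\sum_(j <- r) w j * a j * b j) => S.
move: (\sum_(j <- r) w j * a j ^+ 2) => A.
move: (\sum_(j <- r) w j * b j ^+ 2) => B B0 A0 S0 h.
move: (w i) (a i) (b i) (w0 i) (a0 i) (b0 i) => {w a b w0 a0 b0} w a b w0 a0 b0.
have cross : 2 * S * a * b <= A * b ^+ 2 + B * a ^+ 2.
  rewrite -ler_sqr ?nnegrE ?addr_ge0 ?mulr_ge0 ?sqr_ge0//.
  have h1 : S ^+ 2 * (a ^+ 2 * b ^+ 2) <= A * B * (a ^+ 2 * b ^+ 2).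
    by rewrite ler_wpM2r// mulr_ge0 ?sqr_ge0.
  have := sqr_ge0 (A * b ^+ 2 - B * a ^+ 2); nra.
have := ler_wpM2l w0 cross; nra.
Qed.

Section Chains.
Variables (R : realType) (V : lmodType R[i]) (dot : V -> V -> R[i]).
Hypothesis dotP : semi_inner dot.
Local Notation nrm := (nrm dot).
Local Notation nsq := (nsq dot).
Local Notation proj := (proj dot).
Local Notation orthonormal := (orthonormal dot).
Local Notation ftens := (ftens dot).
Local Notation approx := (approx dot).

(** Collect orthonormal vectors on which the weighted frame sum exceeds the
    threshold W g^2 / m.  By Bessel's inequality fewer than m of them exist, so
    a maximal collection leaves nothing large in its orthogonal complement. *)
Lemma small_frame_complement (I : Type) (r : seq I) (w : I -> R) (e : I -> V)
    (W g : R) (m : nat) : (0 < m)%N ->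
  (forall i, 0 <= w i) -> (forall i, nrm (e i) <= g) ->
  \sum_(i <- r) w i <= W ->
  exists2 s, orthonormal s /\ (size s <= m)%N &
    forall x, {in s, forall y, dot x y = 0} ->
      \sum_(i <- r) w i * cmod (dot (e i) x) ^+ 2 <= W * g ^+ 2 / m%:R * nsq x.
Proof.
move=> m0 w0 eg wW; set thr := W * g ^+ 2 / m%:R.
have mp : 0 < m%:R :> R by rewrite ltr0n.
pose F x := \sum_(i <- r) w i * cmod (dot (e i) x) ^+ 2.
suff main k : (k <= m)%N ->
    (exists2 s, orthonormal s /\ (size s <= m)%N &
      forall x, {in s, forall y, dot x y = 0} -> F x <= thr * nsq x) \/
    (exists2 s, orthonormal s /\ size s = k & {in s, forall y, thr < F y}).
  have [//|[s [on sm] hs]] := main m (leqnn m).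
  suff : \sum_(y <- s) F y <= W * g ^+ 2.
    rewrite leNgt; case/negP; case: s sm hs {on} => [m00|y s sm hs].
      by move: m0; rewrite -m00.
    have -> : W * g ^+ 2 = \sum_(z <- y :: s) thr.
      rewrite big_const_seq count_predT iter_addr_0 sm -mulr_natr /thr.
      by rewrite divfK ?gt_eqF.
    rewrite !big_cons ltr_leD ?hs ?mem_head//.
    rewrite big_seq [leRHS]big_seq ler_sum// => z zs; rewrite ltW// hs//.
    by rewrite inE zs orbT.
  rewrite /F exchange_big/= (@le_trans _ _ (\sum_(i <- r) w i * g ^+ 2))//.
    apply: ler_sum => i _; rewrite -mulr_sumr ler_wpM2l//.
    rewrite (le_trans (bessel dotP _ on))// -(sqr_nrm dotP).
    by rewrite ler_sqr ?nnegrE ?nrm_ge0// (le_trans _ (eg i))// nrm_ge0.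
  by rewrite -mulr_suml ler_wpM2r ?sqr_ge0.
elim: k => [|k IH] km; first by right; exists [::].
have [|[s [on sk] hs]] := IH (ltnW km); first by left.
have [good|] := pselect (forall x, {in s, forall y, dot x y = 0} ->
    F x <= thr * nsq x).
  by left; exists s => //; split=> //; rewrite sk ltnW.
move=> /existsNP[x /not_implyP[xs /negP]]; rewrite -ltNge => hx; right.
have xn0 : nrm x != 0.
  apply/eqP => x0; move: hx; rewrite -(sqr_nrm dotP) x0 expr0n mulr0 /F.
  rewrite big1 ?ltxx// => i _.
  by rewrite (dotC dotP) (dot_null dotP _ x0) rmorph0 cmod0 expr0n mulr0.
have xp : 0 < nrm x by rewrite lt_neqAle eq_sym xn0 nrm_ge0.
exists ((nrm x)^-1%:C *: x :: s).
  split; last by rewrite /= sk.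
  split => //.
    rewrite (dotxx dotP) (nsqZ dotP) cmodR ger0_norm ?invr_ge0 ?nrm_ge0//.
    by rewrite -(sqr_nrm dotP) -exprMn mulVf// expr1n.
  by move=> y ys; rewrite (dotZl dotP) xs// mulr0.
move=> y; rewrite inE => /predU1P[->|]; last exact: hs.
have -> : F ((nrm x)^-1%:C *: x) = F x / nsq x.
  rewrite /F mulr_suml; apply: eq_bigr => i _.
  rewrite (dotZr dotP) cmodM cmodJ cmodR ger0_norm ?invr_ge0 ?nrm_ge0//.
  by rewrite exprMn exprVn (sqr_nrm dotP); ring.
by rewrite ltr_pdivlMr// -(sqr_nrm dotP) exprn_gt0.
Qed.

(** The singular numbers of an operator of nuclear norm at most W b g are
    O(W b g / m): compress to the complements of two spaces of dimension at most m, one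
    for each side, on which the two frame sums are small. *)
Lemma approx_nuclear (I : Type) (r : seq I) (c : I -> R[i]) (v e : I -> V)
    (W b g : R) (m : nat) : (0 < m)%N -> 0 <= b -> 0 <= g ->
  (forall i, nrm (v i) <= b) -> (forall i, nrm (e i) <= g) ->
  \sum_(i <- r) cmod (c i) <= W ->
  approx (m + m) (W * b * g / m%:R)
    (fun f => \sum_(i <- r) (c i * dot f (v i)) *: e i).
Proof.
move=> m0 b0 g0 vb eg cW; set E := fun f => _.
have [s [ons sm] hs] := small_frame_complement m0 (fun i => cmod_ge0 (c i)) eg cW.
have [t [ont tm] ht] := small_frame_complement m0 (fun i => cmod_ge0 (c i)) vb cW.
have W0 : 0 <= W by rewrite (le_trans _ cW)// sumr_ge0// => i _; rewrite cmod_ge0.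
have mp : 0 < m%:R :> R by rewrite ltr0n.
have ED x y : E (x + y) = E x + E y.
  by rewrite /E -big_split; apply: eq_bigr => i _; rewrite (dotDl dotP) mulrDr scalerDl.
have EZ a x : E (a *: x) = a *: E x.
  rewrite /E scaler_sumr; apply: eq_bigr => i _.
  by rewrite (dotZl dotP) scalerA mulrCA.
have E0 : E 0 = 0 by have := EZ 0 0; rewrite !scale0r.
exists ([seq (x, \sum_(i <- r) ((c i * dot (e i) x)^*%C *: v i)) | x <- s] ++
        [seq (E y - proj s (E y), y) | y <- t]).
  by rewrite size_cat !size_map leq_add.
move=> f; rewrite ftens_cat /ftens !big_map /=.
have -> : \sum_(x <- s) dot f (\sum_(i <- r) ((c i * dot (e i) x)^*%C *: v i)) *: x
    = proj s (E f).
  apply: eq_bigr => x _; congr (_ *: _).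
  rewrite (dot_sumr dotP) (dot_suml dotP); apply: eq_bigr => i _.
  by rewrite (dotZr dotP) conjcK (dotZl dotP); ring.
have -> : \sum_(y <- t) dot f y *: (E y - proj s (E y))
    = E (proj t f) - proj s (E (proj t f)).
  have -> : E (proj t f) = \sum_(y <- t) dot f y *: E y.
    by rewrite /proj (big_morph E ED E0); apply: eq_bigr => y _; exact: EZ.
  rewrite (big_morph (proj s) (projD dotP s) (proj0 dotP s)) -sumrB.
  by apply: eq_bigr => y _; rewrite (projZ dotP) scalerBr.
pose x := f - proj t f; pose D := E x - proj s (E x).
have -> : E f - (proj s (E f) + (E (proj t f) - proj s (E (proj t f)))) = D.
  have fE : f = x + proj t f by rewrite subrK.
  rewrite /D {1 2}fE ED (projD dotP).
  by rewrite [X in _ - X]addrACA subrr addr0 opprD addrACA subrr addr0.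
have xt : {in t, forall y, dot x y = 0} by exact: proj_orth.
have Ds : {in s, forall y, dot D y = 0} by exact: proj_orth.
have nsqD_le : nsq D <= \sum_(i <- r) cmod (c i) * cmod (dot (v i) x) * cmod (dot (e i) D).
  have -> : nsq D = complex.Re (dot (E x) D).
    rewrite /D -/(D) -[in RHS](subrK (proj s (E x)) (E x)) -/D (dotDl dotP).
    rewrite [dot (proj _ _) _](_ : _ = 0) ?addr0//.
    rewrite /proj (dot_suml dotP) big_seq big1// => y ys.
    by rewrite (dotZl dotP) (dotC dotP D) Ds// rmorph0 mulr0.
  rewrite (le_trans (Re_le_cmod _))// /E (dot_suml dotP) (le_trans (cmod_sum _ _))//.
  apply: ler_sum => i _.
  by rewrite (dotZl dotP) !cmodM (dotC dotP (v i)) cmodJ.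
set k := W * b * g / m%:R.
have k0 : 0 <= k by rewrite divr_ge0 ?mulr_ge0.
have kx : nrm D <= k * nrm x.
  have [->|Dn0] := eqVneq (nrm D) 0; first by rewrite mulr_ge0 ?nrm_ge0.
  have Dp : 0 < nrm D by rewrite lt_neqAle eq_sym Dn0 nrm_ge0.
  rewrite -(ler_pM2r Dp) -ler_sqr ?nnegrE ?mulr_ge0 ?nrm_ge0//.
  rewrite -expr2 (sqr_nrm dotP).
  have h1 : nsq D ^+ 2 <= (\sum_(i <- r) cmod (c i) * cmod (dot (v i) x) ^+ 2) *
      (\sum_(i <- r) cmod (c i) * cmod (dot (e i) D) ^+ 2).
    apply: (@le_trans _ _ ((\sum_(i <- r) cmod (c i) * cmod (dot (v i) x) *
        cmod (dot (e i) D)) ^+ 2)).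
      rewrite ler_sqr ?nnegrE ?(nsq_ge0 dotP)//.
      by apply: sumr_ge0 => i _; rewrite !mulr_ge0 ?cmod_ge0.
    by apply: weighted_cauchy_schwarz => i; rewrite cmod_ge0.
  rewrite (le_trans h1)//.
  rewrite (@le_trans _ _ ((W * b ^+ 2 / m%:R * nsq x) * (W * g ^+ 2 / m%:R * nsq D)))//.
    apply: ler_pM; rewrite ?(ht _ xt) ?(hs _ Ds)//;
      by apply: sumr_ge0 => i _; rewrite mulr_ge0 ?sqr_ge0 ?cmod_ge0.
  by rewrite -!(sqr_nrm dotP) /k le_eqVlt; apply/orP; left; apply/eqP; field; rewrite gt_eqF.
by rewrite (le_trans kx)// ler_wpM2l// (nrm_subproj dotP).
Qed.

End Chains.

(** * Multipliers along a chain of projections *)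

Section ChainMultiplier.
Variables (R : realType) (V : lmodType R[i]) (dot : V -> V -> R[i]).
Hypothesis dotP : semi_inner dot.
Local Notation nrm := (nrm dot).
Local Notation nsq := (nsq dot).
Local Notation ftens := (ftens dot).
Local Notation approx := (approx dot).

Definition proj_chain (q : nat) (P : 'I_q -> V -> V) : Prop :=
  [/\ forall t a x y, P t (a *: x + y) = a *: P t x + P t y,
      forall t x y, dot (P t x) y = dot x (P t y)
    & forall s t, (forall x, P s (P t x) = P s x /\ P t (P s x) = P s x) \/
                  (forall x, P s (P t x) = P t x /\ P t (P s x) = P t x)].

(** For P t the multiplication by the indicator of an initial segment L_t this
    is the Schur multiplier with symbol sum_t c_t 1_{L_t}(max(x, y)), because
    max(x, y) lies in L_t exactly when both x and y do. *)
Definition chain_mult (q : nat) (P : 'I_q -> V -> V) (c : 'I_q -> R[i])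
  (T : V -> V) (f : V) : V := \sum_t c t *: P t (T (P t f)).

Variables (q : nat) (P : 'I_q -> V -> V) (c : 'I_q -> R[i]).
Hypothesis PP : proj_chain P.
Local Notation Omega := (chain_mult P c).

Lemma chain_proj_lin t a x y : P t (a *: x + y) = a *: P t x + P t y.
Proof. by case: PP. Qed.

Lemma chain_projD t x y : P t (x + y) = P t x + P t y.
Proof. by rewrite -{1}[x]scale1r chain_proj_lin scale1r. Qed.

Lemma chain_proj0 t : P t 0 = 0.
Proof. by apply: (addrI (P t 0)); rewrite -chain_projD !addr0. Qed.

Lemma chain_projZ t a x : P t (a *: x) = a *: P t x.
Proof. by rewrite -[a *: x]addr0 chain_proj_lin chain_proj0 addr0. Qed.

Lemma chain_projB t x y : P t (x - y) = P t x - P t y.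
Proof. by rewrite -scaleN1r chain_projD chain_projZ scaleN1r. Qed.

Lemma chain_proj_dot t x y : dot (P t x) y = dot x (P t y).
Proof. by case: PP. Qed.

Lemma chain_proj_id t x : P t (P t x) = P t x.
Proof. by case: PP => _ _ h; case: (h t t) => /(_ x)[]. Qed.

Lemma chain_proj_nsq t x : nsq (P t x) <= nsq x.
Proof.
rewrite -[in leRHS](subrK (P t x) x) (nsqD_orth dotP) ?lerDr ?(nsq_ge0 dotP)//.
by rewrite -chain_proj_dot chain_projB chain_proj_id subrr (dot0l dotP).
Qed.

Lemma chain_proj_nrm t x : nrm (P t x) <= nrm x.
Proof. by rewrite ler_sqrt ?(nsq_ge0 dotP)// chain_proj_nsq. Qed.

Lemma chain_proj_sub (s t : 'I_q) x :
  (forall x, P s (P t x) = P s x /\ P t (P s x) = P s x) ->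
  nsq (P t x - P s x) = nsq (P t x) - nsq (P s x).
Proof.
move=> st; apply/eqP; rewrite eq_sym subr_eq -(nsqD_orth dotP) ?subrK//.
rewrite -chain_proj_dot chain_projB.
by rewrite (st x).1 chain_proj_id subrr (dot0l dotP).
Qed.

Lemma chain_mult_bound (M a : R) (T : V -> V) : 0 <= a ->
  \sum_t cmod (c t) <= M ->
  (forall f, nrm (T f) <= a * nrm f) -> forall f, nrm (Omega T f) <= M * a * nrm f.
Proof.
move=> a0 cM Ta f; rewrite (le_trans (nrm_sum dotP _ _))//.
rewrite (@le_trans _ _ (\sum_t cmod (c t) * (a * nrm f)))//.
  apply: ler_sum => t _; rewrite (nrmZ dotP) ler_wpM2l ?cmod_ge0//.
  rewrite (le_trans (chain_proj_nrm _ _))// (le_trans (Ta _))//.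
  by rewrite ler_wpM2l// chain_proj_nrm.
by rewrite -mulr_suml -mulrA ler_wpM2r// mulr_ge0// nrm_ge0.
Qed.

Lemma chain_multB (T T' : V -> V) f :
  Omega (fun g => T g - T' g) f = Omega T f - Omega T' f.
Proof.
by rewrite /chain_mult -sumrB; apply: eq_bigr => t _; rewrite chain_projB scalerBr.
Qed.

(** The squared norms of P t u and P t (v / a), rounded to multiples of 1/n, are
    monotone along the chain, so their sum takes at most 2n + 1 values and
    determines both.  Replacing P t by a fixed representative Q t of its level
    changes u by at most n^{-1/2} and v by at most a n^{-1/2}.  In
    <P t f, v> P t u = <P t f, v> Q t u + <Q t f, v> S t u + <S t f, v> S t u,
    with S t = P t - Q t, the first two terms sum to one rank one operator per
    level each, and both factors of the last are small. *)
Lemma chain_mult_rank1 (u v : V) (a : R) (n : nat) : (0 < n)%N -> 0 < a ->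
  nrm u <= 1 -> nrm v <= a ->
  exists (s : seq (V * V)) (u' v' : 'I_q -> V),
    [/\ (size s <= 2 * (2 * n).+1)%N,
        forall t, nrm (u' t) <= Num.sqrt (n%:R^-1),
        forall t, nrm (v' t) <= a * Num.sqrt (n%:R^-1)
      & forall f, \sum_t (c t * dot (P t f) v) *: P t u =
          ftens s f + \sum_t (c t * dot f (v' t)) *: u' t].
Proof.
move=> n0 a0 u1 va.
have np : 0 < n%:R :> R by rewrite ltr0n.
pose lev w t := Num.truncn (n%:R * nsq (P t w)).
have lev_le w t : nrm w <= 1 -> (lev w t <= n)%N.
  move=> w1; rewrite /lev -[leqRHS](@natrK R) Num.Theory.le_truncn//.
  rewrite ler_piMr ?(ltW np)// (le_trans (chain_proj_nsq _ _))//.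
  by rewrite -(sqr_nrm dotP) expr_le1// nrm_ge0.
have lev_mono w s t : (forall x, P s (P t x) = P s x /\ P t (P s x) = P s x) ->
    (lev w s <= lev w t)%N.
  move=> st; rewrite /lev Num.Theory.le_truncn// ler_wpM2l ?(ltW np)// -subr_ge0.
  by rewrite -chain_proj_sub// (nsq_ge0 dotP).
have lev_eq w s t : lev w s = lev w t -> nrm (P t w - P s w) <= Num.sqrt (n%:R^-1).
  wlog st : s t / (forall x, P s (P t x) = P s x /\ P t (P s x) = P s x).
    move=> h e; case: PP => _ _ /(_ s t)[st|ts]; first exact: h.
    by rewrite -opprB (nrmN dotP) h// => x; have [? ?] := ts x.
  move=> e; rewrite ler_sqrt ?invr_ge0 ?ler0n// chain_proj_sub//.
  have := Num.Theory.truncn_itv (mulr_ge0 (ltW np) (nsq_ge0 dotP (P t w))).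
  have := Num.Theory.truncn_itv (mulr_ge0 (ltW np) (nsq_ge0 dotP (P s w))).
  rewrite -/(lev w s) -/(lev w t) e => /andP[h1 _] /andP[_ h2].
  rewrite -(ler_pM2l np) mulfV ?gt_eqF// mulrBr.
  by rewrite -natr1 in h2; lra.
pose z := a^-1%:C *: v.
have vz : v = a%:C *: z by rewrite scalerA -rmorphM divff ?gt_eqF// scale1r.
have z1 : nrm z <= 1.
  by rewrite (nrmZ dotP) cmodR ger0_norm ?invr_ge0 ?(ltW a0)// mulrC ler_pdivrMr// mul1r.
clearbody z.
pose G t : 'I_(2 * n).+1 := inord (lev u t + lev z t).
have GE t : G t = (lev u t + lev z t)%N :> nat.
  by rewrite inordK// ltnS mul2n -addnn leq_add// lev_le.
have G_eq s t : G s = G t -> lev u s = lev u t /\ lev z s = lev z t.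
  move=> /(congr1 val) /=; rewrite !GE.
  case: PP => _ _ /(_ s t)[st|ts].
    have := lev_mono u _ _ st; have := lev_mono z _ _ st; lia.
  have ts' x : P t (P s x) = P t x /\ P s (P t x) = P t x by have [] := ts x.
  have := lev_mono u _ _ ts'; have := lev_mono z _ _ ts'; lia.
pose Q (g : 'I_(2 * n).+1) x : V := if [pick s | G s == g] is Some s then P s x else 0.
have QE t : exists2 s, G s = G t & forall x, Q (G t) x = P s x.
  rewrite /Q; case: pickP => [s /eqP e|/(_ t)]; first by exists s.
  by rewrite eqxx.
pose S t x := P t x - Q (G t) x.
have Su t : nrm (S t u) <= Num.sqrt (n%:R^-1).
  have [s /G_eq[e _]] := QE t; rewrite /S => ->; exact: lev_eq.
have Sv t : nrm (S t v) <= a * Num.sqrt (n%:R^-1).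
  have [s /G_eq[_ e]] := QE t; rewrite /S => ->.
  rewrite vz !chain_projZ -scalerBr (nrmZ dotP) cmodR ger0_norm ?(ltW a0)//.
  by rewrite ler_wpM2l ?lev_eq ?(ltW a0).
pose s1 := [seq (Q g u, \sum_(t | G t == g) (c t)^*%C *: P t v) | g <- enum 'I_(2 * n).+1].
pose s2 := [seq (\sum_(t | G t == g) c t *: S t u, Q g v) | g <- enum 'I_(2 * n).+1].
exists (s1 ++ s2), (fun t => S t u), (fun t => S t v); split => //.
  by rewrite size_cat /s1 /s2 size_map size_enum_ord size_map size_enum_ord addnn -mul2n.
move=> f; rewrite ftens_cat /ftens /s1 /s2 big_map big_enum big_map big_enum /=.
have -> : \sum_g dot f (\sum_(t | G t == g) (c t)^*%C *: P t v) *: Q g u =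
    \sum_t (c t * dot f (P t v)) *: Q (G t) u.
  rewrite [RHS](partition_big G predT)//=; apply: eq_bigr => g _.
  rewrite (dot_sumr dotP) scaler_suml; apply: eq_bigr => t /eqP <-.
  by rewrite (dotZr dotP) conjcK.
have -> : \sum_g dot f (Q g v) *: \sum_(t | G t == g) c t *: S t u =
    \sum_t (c t * dot f (Q (G t) v)) *: S t u.
  rewrite [RHS](partition_big G predT)//=; apply: eq_bigr => g _.
  rewrite scaler_sumr; apply: eq_bigr => t /eqP <-.
  by rewrite scalerA mulrC.
rewrite -!big_split /=; apply: eq_bigr => t _.
rewrite chain_proj_dot -addrA -scalerDl -mulrDr -(dotDr dotP).
have -> : Q (G t) v + S t v = P t v by rewrite addrC subrK.
by rewrite -scalerDr addrC subrK.
Qed.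

Lemma chain_mult_tensor_split (s : seq (V * V)) (a M : R) (n : nat) :
  (0 < n)%N -> 0 < a -> \sum_t cmod (c t) <= M ->
  {in s, forall p, nrm p.1 <= 1 /\ nrm p.2 <= a} ->
  exists (s' : seq (V * V)) (r : seq (R[i] * V * V)),
    [/\ (size s' <= size s * (2 * (2 * n).+1))%N,
        {in r, forall z, nrm z.1.2 <= a * Num.sqrt (n%:R^-1) /\
                         nrm z.2 <= Num.sqrt (n%:R^-1)},
        \sum_(z <- r) cmod z.1.1 <= (size s)%:R * M
      & forall f, Omega (ftens s) f =
          ftens s' f + \sum_(z <- r) (z.1.1 * dot f z.1.2) *: z.2].
Proof.
move=> n0 a0 cM; elim: s => [|p s IH] hs.
  exists [::], [::]; split => //=; first by rewrite big_nil mul0r.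
  move=> f; rewrite /ftens !big_nil addr0 /chain_mult big1// => t _.
  by rewrite big_nil chain_proj0 scaler0.
have [|s' [r [ss' hr Wr hO]]] := IH; first by move=> x xs; apply: hs; rewrite inE xs orbT.
have [p1 p2] := hs p (mem_head _ _).
have [s1 [u' [v' [ss1 hu hv h1]]]] := chain_mult_rank1 n0 a0 p1 p2.
exists (s1 ++ s'), ([seq (c t, v' t, u' t) | t <- enum 'I_q] ++ r); split.
- by rewrite size_cat /= mulSn leq_add.
- move=> z; rewrite mem_cat => /orP[/mapP[t _ ->]|]; last exact: hr.
  by split; [exact: hv|exact: hu].
- rewrite big_cat big_map big_enum /= -natr1 mulrDl mul1r addrC.
  by rewrite lerD.
move=> f; rewrite ftens_cat big_cat big_map big_enum /= addrACA -h1 -hO.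
rewrite /chain_mult -big_split /=; apply: eq_bigr => t _.
by rewrite /ftens big_cons chain_projD chain_projZ scalerDr scalerA.
Qed.

(** The small terms left by the N rank one summands have total nuclear norm at
    most M a N / n, and compressing them at index n N leaves M a / n^2. *)
Lemma approx_chain_mult_tensor (s : seq (V * V)) (a M : R) (n : nat) :
  (0 < n)%N -> 0 < a -> \sum_t cmod (c t) <= M ->
  {in s, forall p, nrm p.1 <= 1 /\ nrm p.2 <= a} ->
  approx (8 * n * size s) (M * a / n%:R ^+ 2) (Omega (ftens s)).
Proof.
move=> n0 a0 cM hs.
have M0 : 0 <= M.
  by rewrite (le_trans _ cM)// sumr_ge0// => t _; rewrite cmod_ge0.
have [s0|sn0] := posnP (size s).
  move/size0nil: s0 => ->; exists [::] => // f.
  rewrite /chain_mult big1 => [|t _].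
    rewrite /ftens big_nil subr0 (nrm0 dotP) mulr_ge0 ?nrm_ge0//.
    by rewrite divr_ge0 ?sqr_ge0// mulr_ge0 ?(ltW a0).
  by rewrite /ftens big_nil chain_proj0 scaler0.
have [s' [r [ss' hr Wr hO]]] := chain_mult_tensor_split n0 a0 cM hs.
pose m := (n * size s)%N.
have m0 : (0 < m)%N by rewrite muln_gt0 n0.
have g0 : 0 <= Num.sqrt (n%:R^-1) :> R by exact: sqrtr_ge0.
pose ev z : V := if z \in r then z.1.2 else 0.
pose ee z : V := if z \in r then z.2 else 0.
have [||||s2 ss2 h2] := @approx_nuclear _ _ _ dotP _ r (fun z => z.1.1) ev ee
  ((size s)%:R * M) (a * Num.sqrt (n%:R^-1)) (Num.sqrt (n%:R^-1)) m m0 _ g0.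
- by rewrite mulr_ge0 ?(ltW a0).
- move=> z; rewrite /ev; case: ifP => [/hr[]//|_].
  by rewrite (nrm0 dotP) mulr_ge0 ?(ltW a0).
- by move=> z; rewrite /ee; case: ifP => [/hr[]//|_]; rewrite (nrm0 dotP).
- exact: Wr.
exists (s' ++ s2).
  rewrite size_cat (leq_trans (leq_add ss' ss2))// /m.
  by nia.
move=> f; rewrite hO ftens_cat opprD addrACA subrr add0r.
have := h2 f; rewrite (eq_big_seq (fun z => (z.1.1 * dot f z.1.2) *: z.2)); last first.
  by move=> z zr; rewrite /ev /ee zr.
move=> h; rewrite (le_trans h)// le_eqVlt; apply/orP; left; apply/eqP; congr (_ * _).
rewrite -!mulrA [Num.sqrt _ * _]mulrA -expr2 sqr_sqrtr ?invr_ge0 ?ler0n//.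
by rewrite /m natrM; field; rewrite !pnatr_eq0 -!lt0n n0 sn0.
Qed.

End ChainMultiplier.

(** * Dyadic decomposition *)

Section Dyadic.
Variables (R : realType) (V : lmodType R[i]) (dot : V -> V -> R[i]).
Hypothesis dotP : semi_inner dot.
Local Notation nrm := (nrm dot).
Local Notation ftens := (ftens dot).
Local Notation approx := (approx dot).

(** Linearity and the range are understood modulo null vectors.  With a strict
    bound on the rank, the dyadic bounds 2^k start from a null operator. *)
Definition rank_lt (n : nat) (S : V -> V) : Prop :=
  (forall a x y, nrm (S (a *: x + y) - (a *: S x + S y)) = 0) /\
  exists2 g : seq V, (size g < n)%N &
    forall f, exists c : nat -> R[i],
      nrm (S f - \sum_(i < size g) c i *: g`_i) = 0.

Lemma nrm_le0 x : nrm x <= 0 -> nrm x = 0.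
Proof. by move=> h; apply/eqP; rewrite eq_le h nrm_ge0. Qed.

Lemma nrmB_null x y x' y' : nrm (x - x') = 0 -> nrm (y - y') = 0 ->
  nrm ((x - y) - (x' - y')) = 0.
Proof.
move=> hx hy; apply: nrm_le0.
rewrite opprB [y' - x']addrC addrACA [- y + y']addrC -[y' - y]opprB.
by rewrite (le_trans (nrmB dotP _ _))// hx hy addr0.
Qed.

Lemma difference_tensor (S S' : V -> V) (n n' : nat) (a e : R) : 0 <= a -> 0 < e ->
  rank_lt n S -> rank_lt n' S' -> (forall f, nrm (S' f - S f) <= a * nrm f) ->
  exists s : seq (V * V),
    [/\ (size s <= n + n')%N,
        {in s, forall p, nrm p.1 <= 1 /\ nrm p.2 <= a}
      & forall f, nrm ((S' f - S f) - ftens s f) <= e * nrm f].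
Proof.
move=> a0 e0 [lin [g gn hg]] [lin' [g' gn' hg']] bnd.
have [||s [ss h1 h2]] := @finite_rank_tensor _ _ _ dotP (fun f => S' f - S f) a e
    (g' ++ g) a0 e0 _ bnd.
- move=> c x y.
  have -> : c *: (S' x - S x) + (S' y - S y) =
      (c *: S' x + S' y) - (c *: S x + S y) by rewrite scalerBr opprD addrACA.
  by apply: nrmB_null; [exact: lin'|exact: lin].
- move=> f; have [c hc] := hg f; have [c' hc'] := hg' f.
  exists (fun i => if (i < size g')%N then c' i else - c (i - size g')%N).
  rewrite size_cat big_split_ord /=.
  rewrite (eq_bigr (fun i : 'I_(size g') => c' i *: g'`_i)); last first.
    by move=> i _; rewrite ltn_ord nth_cat ltn_ord.
  rewrite [X in _ - (_ + X)](_ : _ = - \sum_(i < size g) c i *: g`_i); last first.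
    rewrite -sumrN; apply: eq_bigr => i _.
    by rewrite ltnNge leq_addr /= nth_cat ltnNge leq_addr /= addKn scaleNr.
  exact: nrmB_null.
by exists s; split=> //; rewrite (leq_trans ss)// size_cat addnC leq_add// ltnW.
Qed.

Variables (q : nat) (P : 'I_q -> V -> V) (c : 'I_q -> R[i]).
Hypothesis PP : proj_chain dot P.
Local Notation Omega := (chain_mult P c).

(** T is split into the pieces S (k+1) - S k, of rank at most 3 2^k and norm at
    most 2 sg k, and the remainder T - S m.  Piece k is given 8 nu (m - k) times
    its rank, which divides its contribution by the square of nu (m - k). *)
Lemma approx_chain_mult (M : R) (T : V -> V) (S : nat -> V -> V)
    (sg : nat -> R) (nu : nat -> nat) (m : nat) :
  \sum_t cmod (c t) <= M ->
  (forall k, 0 < sg k) -> (forall k, sg k.+1 <= sg k) ->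
  (forall k, rank_lt (2 ^ k) (S k)) ->
  (forall k f, nrm (T f - S k f) <= sg k * nrm f) ->
  (forall k, (0 < nu k)%N) ->
  approx (\sum_(k < m) 24 * nu (m - k) * 2 ^ k)
    (2 * M * (sg m + \sum_(k < m) sg k / (nu (m - k)%N)%:R ^+ 2)) (Omega T).
Proof.
move=> cM sg0 sgS rS TS nu0.
have M0 : 0 <= M.
  by rewrite (le_trans _ cM)// sumr_ge0// => t _; rewrite cmod_ge0.
pose e := sg m / m.+1%:R.
have e0 : 0 < e by rewrite divr_gt0.
have /choice[s hs] k : exists s : seq (V * V),
    [/\ (size s <= 3 * 2 ^ k)%N,
        {in s, forall p, nrm p.1 <= 1 /\ nrm p.2 <= 2 * sg k}
      & forall f, nrm ((S k.+1 f - S k f) - ftens s f) <= e * nrm f].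
  have a0 : 0 <= 2 * sg k by rewrite mulr_ge0 ?ltW.
  have [f|s [ss h1 h2]] := difference_tensor a0 e0 (rS k) (rS k.+1).
    have -> : S k.+1 f - S k f = (T f - S k f) - (T f - S k.+1 f).
      by rewrite opprB [RHS]addrC addrA subrK.
    rewrite (le_trans (nrmB dotP _ _))// (le_trans (lerD (TS k f) (TS k.+1 f)))//.
    by rewrite mulr_natl mulr2n mulrDl lerD2l ler_wpM2r ?nrm_ge0.
  by exists s; split => //; rewrite (leq_trans ss)// expnS -mulSn.
pose E f := T f - \sum_(k < m) ftens (s k) f.
have S0 f : nrm (S 0 f) = 0.
  have [_ [g g0 /(_ f)[d]]] := rS 0%N.
  have -> : g = [::] by apply: size0nil; move: g0; rewrite expn0 ltnS leqn0 => /eqP.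
  by rewrite big_ord0 subr0.
have Ebnd f : nrm (E f) <= (2 * sg m) * nrm f.
  have tele : S m f = S 0%N f + \sum_(k < m) (S k.+1 f - S k f).
    by rewrite -(big_mkord predT (fun k => S k.+1 f - S k f)) telescope_sumr// addrC subrK.
  have -> : E f = (T f - S m f) + S 0%N f +
      \sum_(k < m) ((S k.+1 f - S k f) - ftens (s k) f).
    by rewrite sumrB addrA -[_ + S 0%N f + _]addrA -tele subrK.
  rewrite (le_trans (nrmD dotP _ _))// (@le_trans _ _ (sg m * nrm f + sg m * nrm f))//.
    rewrite lerD// ?(le_trans (nrmD dotP _ _)) ?S0 ?addr0//.
    rewrite (le_trans (nrm_sum dotP _ _))//.
    rewrite (@le_trans _ _ (\sum_(k < m) e * nrm f))//.
      by apply: ler_sum => k _; have [_ _] := hs k; exact.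
    rewrite sumr_const card_ord -mulr_natr mulrAC ler_wpM2r ?nrm_ge0// /e mulrAC.
    by rewrite ler_pdivrMr// ler_wpM2l ?ler_nat// ltW.
  by rewrite mulr_natl mulr2n mulrDl.
have OE f : Omega T f = Omega E f + \sum_(k < m) Omega (ftens (s k)) f.
  rewrite /chain_mult exchange_big -big_split /=; apply: eq_bigr => t _.
  rewrite -scaler_sumr -scalerDr; congr (_ *: _).
  rewrite -(big_morph (P t) (chain_projD PP t) (chain_proj0 PP t)).
  by rewrite -(chain_projD PP) subrK.
apply: (approx_eq dotP (T := fun f => Omega E f + \sum_(k < m) Omega (ftens (s k)) f)).
  by move=> f; rewrite OE subrr (nrm0 dotP).
apply: (approx_le (m := (0 + \sum_(k < m) 24 * nu (m - k) * 2 ^ k)%N)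
  (sg := M * (2 * sg m) + \sum_(k < m) M * (2 * sg k) / (nu (m - k)%N)%:R ^+ 2)) => //.
  rewrite mulrDr; apply: lerD; first by rewrite mulrCA mulrA.
  rewrite mulr_sumr ler_sum// => k _.
  by rewrite le_eqVlt; apply/orP; left; apply/eqP; ring.
apply: (approxD dotP).
  apply: approx0; apply: chain_mult_bound => //.
  by rewrite mulr_ge0 ?ltW.
apply: (approx_sum dotP (m := fun k => (24 * nu (m - k) * 2 ^ k)%N)
  (sg := fun k => M * (2 * sg k) / (nu (m - k)%N)%:R ^+ 2)
  (T := fun k => Omega (ftens (s k)))) => k km.
have [ss h1 h2] := hs k.
have h := approx_chain_mult_tensor dotP PP (nu0 (m - k)%N) _ cM h1.
apply: (approx_le _ _ (h _)) => //; last by rewrite mulr_gt0.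
by rewrite (leq_trans (leq_mul (leqnn _) ss))//; lia.
Qed.

End Dyadic.

(** * Sums over dyadic blocks *)

Section DyadicSums.
Variable R : realType.
Implicit Types (p : R) (a s t : nat -> R).

Lemma ler_powR_base p x y : 0 <= p -> 0 <= x -> x <= y -> x `^ p <= y `^ p.
Proof.
by move=> p0 x0 xy; rewrite ge0_ler_powR// nnegrE// (le_trans x0).
Qed.

Lemma powR_gt1 (x q : R) : 1 < x -> 0 < q -> 1 < x `^ q.
Proof.
move=> x1 q0; have x0 : 0 < x by rewrite (lt_trans _ x1).
have := @gt0_ltr_powR R q q0 1 x; rewrite powR1; apply => //.
  by rewrite nnegrE ler01.
by rewrite nnegrE ltW.
Qed.

Lemma geometric_bound (r : R) m : 0 <= r -> r < 1 ->
  \sum_(j < m) r ^+ j <= (1 - r)^-1.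
Proof.
move=> r0 r1; have r10 : 0 < 1 - r by rewrite subr_gt0.
rewrite -[leRHS]mul1r ler_pdivlMr// mulrC -opprB mulNr -subrX1 opprB.
by rewrite lerBlDr lerDl exprn_ge0.
Qed.

(** Rank multipliers: nu j ~ x^j with x < 2 keeps the total rank O(2^m), and
    2 x^{-2p} < 1, which is possible exactly because p > 1/2, makes the
    resulting gains summable. *)
Lemma rank_multipliers p : 2^-1 < p -> exists (nu : nat -> nat) (d : nat) (lam : R),
  [/\ forall j, (0 < nu j)%N,
      forall m, (\sum_(k < m) 24 * nu (m - k) * 2 ^ k <= 2 ^ (m + d))%N,
      0 < lam /\ 2 * lam `^ p < 1
    & forall j, ((nu j)%:R ^+ 2)^-1 <= lam ^+ j].
Proof.
move=> p2; have p0 : 0 < p by rewrite (lt_trans _ p2).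
(* the midpoint of the interval between 1/(2p) and 1, which is nonempty
   because p > 1/2; then x = 2^th satisfies x < 2 < x^{2p} *)
pose th := ((2 * p)^-1 + 1) / 2.
have th1 : th < 1.
  have : (2 * p)^-1 < 1 by rewrite invf_lt1 ?mulr_gt0// -ltr_pdivrMl// mulr1.
  by rewrite /th; move: (2 * p)^-1 => u; lra.
have th0 : 0 <= th.
  have : 0 <= (2 * p)^-1 by rewrite invr_ge0 mulr_ge0// ltW.
  by rewrite /th; move: (2 * p)^-1 => u; lra.
pose x : R := 2 `^ th.
have x0 : 0 < x by rewrite powR_gt0.
have x1 : 1 <= x by rewrite -(powRr0 2) ler_powR// ler1n.
have x2 : x < 2.
  rewrite /x -[ltRHS](@powRr1 _ 2)// lt_neqAle ler_powR ?(ltW th1) ?ler1n// andbT.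
  apply/eqP => /(congr1 (@ln R)); rewrite !ln_powR => /mulIf h.
  by move: th1; rewrite h ?ltxx// gt_eqF// ln_gt0// ltr1n.
have nuE j : x ^+ j <= (Num.truncn (x ^+ j)).+1%:R.
  rewrite ltW//; have /andP[] := Num.Theory.truncn_itv (exprn_ge0 j (ltW x0)).
  by [].
have nuE2 j : (Num.truncn (x ^+ j)).+1%:R <= 2 * x ^+ j.
  have /andP[h _] := Num.Theory.truncn_itv (exprn_ge0 j (ltW x0)).
  have : 1 <= x ^+ j by rewrite exprn_ege1.
  by rewrite -natr1; lra.
have h1 : 0 < 1 - x / 2 by lra.
(* 48 is 24 times the factor 2 lost by rounding x^j up *)
pose d := (Num.truncn (48 * (1 - x / 2)^-1)).+1.
exists (fun j => (Num.truncn (x ^+ j)).+1), d, (x ^+ 2)^-1; split => //.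
- move=> m; rewrite -(ler_nat R) natr_sum.
  apply: (@le_trans _ _ (\sum_(k < m) 48 * 2 ^+ m * (x / 2) ^+ (m - k))).
    apply: ler_sum => k _; rewrite !natrM natrX.
    rewrite exprMn exprVn exprB ?unitfE// ?(ltnW (ltn_ord k))// invf_div.
    have := nuE2 (m - k)%N; set A := (Num.truncn _).+1%:R => hA.
    have k0 : 0 < 2 ^+ k :> R by rewrite exprn_gt0.
    rewrite (_ : 48 * 2 ^+ m * _ = 24 * (2 * x ^+ (m - k)) * 2 ^+ k); last first.
      by field; rewrite expf_neq0.
    by rewrite ler_wpM2r ?(ltW k0)// ler_wpM2l.
  rewrite -mulr_sumr natrX exprD [48 * _]mulrC -mulrA ler_wpM2l ?exprn_ge0//.
  apply: (@le_trans _ _ (48 * (1 - x / 2)^-1)).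
    rewrite ler_wpM2l//.
    apply: (@le_trans _ _ (\sum_(j < m.+1) (x / 2) ^+ j)); last first.
      by apply: geometric_bound; lra.
    rewrite big_ord_recl/= (reindex_inj rev_ord_inj)/=.
    rewrite (eq_bigr (fun i : 'I_m => (x / 2) ^+ (bump 0 i))); last first.
      by move=> i _; rewrite subKn// /bump.
    by rewrite lerDr expr0.
  have /andP[_ h] : (Num.truncn (48 * (1 - x / 2)^-1))%:R <= 48 * (1 - x / 2)^-1 <
      (Num.truncn (48 * (1 - x / 2)^-1)).+1%:R.
    by apply: Num.Theory.truncn_itv; rewrite mulr_ge0// invr_ge0 ltW.
  rewrite (le_trans (ltW h))// -natrX ler_nat.
  by rewrite -/d ltnW// ltn_expl.
- split; first by rewrite invr_gt0 exprn_gt0.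
  have xp : 2 < (x ^+ 2) `^ p.
    rewrite -powR_mulrn ?(ltW x0)// -!powRrM /th.
    rewrite (_ : _ * _ = 1 + (p - 2^-1)); last by field; rewrite gt_eqF.
    rewrite powRD ?pnatr_eq0 ?implybT// powRr1// ltr_pMr//.
    by rewrite powR_gt1 ?subr_gt0// ltr1n.
  rewrite -powR_inv1 ?sqr_ge0// -powRrM mulN1r powRN -ltr_pdivlMr ?invr_gt0 ?powR_gt0 ?exprn_gt0//.
  by rewrite invrK mul1r.
move=> j /=; rewrite exprVn lef_pV2 ?posrE ?exprn_gt0//.
by rewrite -exprM mulnC exprM lerXn2r// ?nnegrE ?exprn_ge0 ?(ltW x0).
Qed.

(** The recursion E (m+1) = lam E m + sg (m+1) loses only a factor arbitrarily
    close to 1 in (a + b)^p <= y^p a^p + K b^p, for every p > 0. *)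
Lemma sum_geometric_recursion p (lam : R) (sg E : nat -> R) (B : R) :
  0 < p -> 0 < lam -> 2 * lam `^ p < 1 -> (forall k, 0 <= sg k) ->
  (forall k, 0 <= E k) -> (forall k, E k.+1 = lam * E k + sg k.+1) ->
  (forall m, \sum_(k < m) 2 ^+ k * sg k `^ p <= B) ->
  exists B', forall m, \sum_(k < m) 2 ^+ k * E k `^ p <= B'.
Proof.
move=> p0 l0 lp sg0 E0 ES sB.
pose r := 2 * lam `^ p.
have r0 : 0 < r by rewrite mulr_gt0// powR_gt0.
(* chosen so that 2 (y lam)^p is the square root of r, still below 1 *)
pose y := r `^ (- (2 * p)^-1).
have yp : y `^ p = (Num.sqrt r)^-1.
  rewrite -powRrM -powR12_sqrt ?ltW// -powRN; congr (_ `^ _).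
  by field; rewrite gt_eqF.
have sr0 : 0 < Num.sqrt r by rewrite sqrtr_gt0.
have sr1 : Num.sqrt r < 1 by rewrite -[ltRHS]sqrtr1 ltr_sqrt.
have y0 : 0 <= y by exact: powR_ge0.
have y1 : 1 < y.
  rewrite real_ltNge ?num_real//; apply/negP => y1.
  have : y `^ p <= 1 `^ p by apply: ler_powR_base => //; exact: ltW.
  by rewrite yp powR1 invf_le1// leNgt sr1.
pose K := (y / (y - 1)) `^ p.
have K0 : 0 <= K by exact: powR_ge0.
have yy : 0 < y - 1 by rewrite subr_gt0.
have split_pow (a b : R) : 0 <= a -> 0 <= b -> (a + b) `^ p <= y `^ p * a `^ p + K * b `^ p.
  move=> a0 b0; have [ba|ab] := leP b ((y - 1) * a).
    apply: (@le_trans _ _ ((y * a) `^ p)).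
      by apply: ler_powR_base; rewrite ?(ltW p0) ?addr_ge0//; lra.
    by rewrite powRM// lerDl mulr_ge0// powR_ge0.
  apply: (@le_trans _ _ ((y / (y - 1) * b) `^ p)).
    apply: ler_powR_base; rewrite ?(ltW p0) ?addr_ge0//.
    rewrite mulrAC ler_pdivlMr//; nra.
  by rewrite powRM// ?divr_ge0 ?(ltW yy)// lerDr mulr_ge0// powR_ge0.
pose b k := 2 ^+ k * E k `^ p.
have b0 k : 0 <= b k by rewrite mulr_ge0 ?exprn_ge0 ?powR_ge0.
have step k : b k.+1 <= Num.sqrt r * b k + K * (2 ^+ k.+1 * sg k.+1 `^ p).
  rewrite /b ES (@le_trans _ _ (2 ^+ k.+1 *
    (y `^ p * (lam * E k) `^ p + K * sg k.+1 `^ p)))//.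
    by rewrite ler_wpM2l ?exprn_ge0// split_pow// mulr_ge0// ltW.
  rewrite mulrDr [K * (_ * _)]mulrCA lerD2r powRM ?(ltW l0)// yp.
  have -> : 2 ^+ k.+1 * ((Num.sqrt r)^-1 * (lam `^ p * E k `^ p)) =
      (r / Num.sqrt r) * (2 ^+ k * E k `^ p) by rewrite exprS /r; ring.
  rewrite -{1}(sqr_sqrtr (ltW r0)) expr2 mulfK ?gt_eqF//.
pose X := (b 0%N + K * B) / (1 - Num.sqrt r).
have r10 : 0 < 1 - Num.sqrt r by rewrite subr_gt0.
have B0 : 0 <= B by have := sB 0%N; rewrite big_ord0.
have XE : b 0%N + K * B + Num.sqrt r * X = X by rewrite /X; field; rewrite gt_eqF.
exists X; elim => [|m IH].
  by rewrite big_ord0 divr_ge0 ?(ltW r10)// addr_ge0// mulr_ge0.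
rewrite big_ord_recl /= -/(b 0%N) -XE -addrA lerD2l.
apply: (@le_trans _ _ (\sum_(k < m) (Num.sqrt r * b k + K * (2 ^+ k.+1 * sg k.+1 `^ p)))).
  by apply: ler_sum => k _; exact: step.
rewrite big_split /= -!mulr_sumr addrC lerD//.
  rewrite ler_wpM2l// (le_trans _ (sB m.+1))// big_ord_recl lerDr.
  by rewrite mulr_ge0 ?exprn_ge0 ?powR_ge0.
by rewrite ler_wpM2l ?(ltW sr0).
Qed.

Lemma dyadic_sum_le a (B : R) : {homo a : m n / (m <= n)%N >-> n <= m} ->
  (forall N, \sum_(n < N) a n <= B) -> (forall n, 0 <= a n) ->
  forall m, \sum_(k < m) 2 ^+ k * a (2 ^ k).-1 <= a 0%N + 2 * B.
Proof.
move=> mono sB a0.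
suff h m : \sum_(k < m.+1) 2 ^+ k * a (2 ^ k).-1 <=
    a 0%N + 2 * \sum_(n < (2 ^ m).-1) a n.
  move=> m; apply: (@le_trans _ _ (\sum_(k < m.+1) 2 ^+ k * a (2 ^ k).-1)).
    by rewrite big_ord_recr /= lerDl mulr_ge0 ?exprn_ge0.
  by rewrite (le_trans (h m))// lerD2l ler_wpM2l.
elim: m => [|m IH].
  by rewrite big_ord_recr /= !big_ord0 add0r mulr0 addr0 mul1r.
rewrite big_ord_recr /= (le_trans (lerD IH (lexx _)))// -addrA lerD2l.
have -> : (2 ^ m.+1).-1 = ((2 ^ m).-1 + 2 ^ m)%N.
  by have := expn_gt0 2 m; rewrite expnS; lia.
rewrite big_split_ord /= mulrDr lerD2l exprS -mulrA ler_wpM2l//.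
apply: (@le_trans _ _ (\sum_(i < 2 ^ m) a ((2 ^ m).-1 + 2 ^ m)%N)).
  by rewrite sumr_const card_ord -[leRHS]mulr_natl natrX.
by apply: ler_sum => i _; apply: mono; rewrite leq_add2l ltnW.
Qed.

Lemma sum_le_dyadic a (d : nat) (B : R) : {homo a : m n / (m <= n)%N >-> n <= m} ->
  (forall n, 0 <= a n) ->
  (forall m, \sum_(k < m) 2 ^+ k * a (2 ^ (k + d))%N <= B) ->
  forall N, \sum_(n < N) a n <= 2 ^+ d * a 0%N + 2 ^+ d * B.
Proof.
move=> mono a0 sB N.
suff h m : \sum_(n < 2 ^ (m + d)) a n <=
    2 ^+ d * a 0%N + 2 ^+ d * \sum_(k < m) 2 ^+ k * a (2 ^ (k + d))%N.
  apply: (@le_trans _ _ (\sum_(n < 2 ^ (N + d)) a n)).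
    have NN : (N <= 2 ^ (N + d))%N.
      by rewrite (leq_trans (ltnW (ltn_expl N (ltnSn 1))))// leq_exp2l// leq_addr.
    rewrite -(subnKC NN) big_split_ord /= lerDl sumr_ge0//.
  by rewrite (le_trans (h N))// lerD2l ler_wpM2l ?exprn_ge0.
elim: m => [|m IH].
  rewrite big_ord0 mulr0 addr0 add0n.
  apply: (@le_trans _ _ (\sum_(i < 2 ^ d) a 0%N)).
    by apply: ler_sum => i _; apply: mono.
  by rewrite sumr_const card_ord -[leLHS]mulr_natl natrX.
rewrite addSn expnS mul2n -addnn big_split_ord /= big_ord_recr /= mulrDr addrA.
rewrite lerD//.
apply: (@le_trans _ _ (\sum_(i < 2 ^ (m + d)) a (2 ^ (m + d))%N)).
  by apply: ler_sum => i _; apply: mono; rewrite leq_addr.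
by rewrite sumr_const card_ord -[leLHS]mulr_natl natrX exprD mulrA [2 ^+ d * _]mulrC.
Qed.

(** The summand 4^{-k} keeps the dyadic bounds positive when singular numbers
    vanish; it does not affect summability because 2 4^{-p} < 1. *)
Lemma powR_summable_transfer p : 2^-1 < p ->
  exists (nu : nat -> nat) (d : nat),
  [/\ forall j, (0 < nu j)%N,
      forall m, (\sum_(k < m) 24 * nu (m - k) * 2 ^ k <= 2 ^ (m + d))%N
    & forall (K B : R) (s t : nat -> R), 0 <= K ->
      (forall n, 0 <= s n) -> {homo s : m n / (m <= n)%N >-> n <= m} ->
      (forall n, 0 <= t n) -> {homo t : m n / (m <= n)%N >-> n <= m} ->
      (forall N, \sum_(n < N) s n `^ p <= B) ->
      let sg k := s (2 ^ k).-1 + (4 ^+ k)^-1 in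
      (forall m, t (2 ^ (m + d))%N <=
        K * (sg m + \sum_(k < m) sg k / (nu (m - k)%N)%:R ^+ 2)) ->
      exists B', forall N, \sum_(n < N) t n `^ p <= B'].
Proof.
move=> p2; have p0 : 0 < p by rewrite (lt_trans _ p2).
have [nu [d [lam [nu0 nud [l0 lp] nul]]]] := rank_multipliers p2.
exists nu, d; split => // K B s t K0 s0 smono t0 tmono sB sg tK.
have sg0 k : 0 <= sg k by rewrite addr_ge0// invr_ge0 exprn_ge0.
pose E m := \sum_(k < m.+1) lam ^+ (m - k) * sg k.
have E0 m : 0 <= E m.
  by apply: sumr_ge0 => k _; rewrite mulr_ge0// exprn_ge0// ltW.
have ES m : E m.+1 = lam * E m + sg m.+1.
  rewrite /E big_ord_recr /= subnn expr0 mul1r mulr_sumr; congr (_ + _).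
  by apply: eq_bigr => k _; rewrite subSn ?exprS ?mulrA// -ltnS.
pose r : R := 2 * 4 `^ (- p).
have r0 : 0 <= r by rewrite mulr_ge0// powR_ge0.
have r1 : r < 1.
  rewrite /r; have -> : 4 = 2 `^ 2 :> R by rewrite powR_mulrn// expr2 -natrM.
  rewrite -powRrM -{1}(@powRr1 _ 2)// -powRD ?pnatr_eq0 ?implybT//.
  rewrite (_ : 1 + 2 * - p = - (2 * p - 1)); last by ring.
  rewrite powRN invf_lt1 ?powR_gt0//; apply: powR_gt1; first by rewrite ltr1n.
  by rewrite subr_gt0 -ltr_pdivrMl// mulr1.
have sgB m : \sum_(k < m) 2 ^+ k * sg k `^ p <=
    2 `^ p * (s 0%N `^ p + 2 * B + (1 - r)^-1).
  apply: (@le_trans _ _ (\sum_(k < m) 2 `^ p *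
      (2 ^+ k * s (2 ^ k).-1 `^ p + r ^+ k))).
    apply: ler_sum => k _.
    have e : r ^+ k = 2 ^+ k * ((4 ^+ k)^-1) `^ p.
      rewrite /r exprMn; congr (_ * _).
      rewrite -powR_mulrn ?powR_ge0// -powR_invn// -!powRrM; congr (_ `^ _).
      by rewrite mulrC mulrN mulNr.
    rewrite e -mulrDr mulrCA ler_wpM2l ?exprn_ge0//.
    have a0 := s0 (2 ^ k).-1.
    have b0 : 0 <= (4 ^+ k)^-1 :> R by rewrite invr_ge0 exprn_ge0.
    rewrite /sg; move: (s _) ((4 ^+ k)^-1) a0 b0 => u v a0 b0.
    rewrite mulrDr -!powRM//; have [ab|ba] := leP u v.
      rewrite (@le_trans _ _ ((2 * v) `^ p))// ?lerDr ?powR_ge0//.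
      by apply: ler_powR_base; rewrite ?(ltW p0) ?addr_ge0//; lra.
    rewrite (@le_trans _ _ ((2 * u) `^ p))// ?lerDl ?powR_ge0//.
    by apply: ler_powR_base; rewrite ?(ltW p0) ?addr_ge0//; lra.
  rewrite -mulr_sumr ler_wpM2l ?powR_ge0// big_split /= lerD ?geometric_bound//.
  apply: (@dyadic_sum_le (fun n => s n `^ p)) => // [m' n mn|n]; last exact: powR_ge0.
  by apply: ler_powR_base; rewrite ?(ltW p0)// smono.
have [B1 hB1] := sum_geometric_recursion p0 l0 lp sg0 E0 ES sgB.
have tE m : t (2 ^ (m + d))%N <= K * E m.
  rewrite (le_trans (tK m))// ler_wpM2l// /E big_ord_recr /= subnn expr0 mul1r.
  rewrite [leRHS]addrC lerD2l ler_sum// => k _.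
  by rewrite mulrC ler_wpM2r.
exists (2 ^+ d * t 0%N `^ p + 2 ^+ d * (K `^ p * B1)).
apply: (@sum_le_dyadic (fun n => t n `^ p)) => [m n mn|n|m]; first last.
- apply: (@le_trans _ _ (\sum_(k < m) K `^ p * (2 ^+ k * E k `^ p))).
    apply: ler_sum => k _; rewrite mulrCA ler_wpM2l ?exprn_ge0// -powRM//.
    by apply: ler_powR_base; rewrite ?(ltW p0).
  by rewrite -mulr_sumr ler_wpM2l ?powR_ge0.
- exact: powR_ge0.
- by apply: ler_powR_base; rewrite ?(ltW p0)// tmono.
Qed.

End DyadicSums.

(** * The space of square-integrable functions *)

Section ComplexIntegral.
Variable R : realType.
Local Notation mu := (@lebesgue_measure R).
Implicit Types f g h : R -> R[i].

Lemma cmeasurableD d (T : measurableType d) (f g : T -> R[i]) :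
  cmeasurable f -> cmeasurable g -> cmeasurable (fun x => f x + g x).
Proof.
move=> [f1 f2] [g1 g2]; split.
  by under eq_fun do rewrite ReD; exact: measurable_funD.
by under eq_fun do rewrite ImD; exact: measurable_funD.
Qed.

Lemma cmeasurableB d (T : measurableType d) (f g : T -> R[i]) :
  cmeasurable f -> cmeasurable g -> cmeasurable (fun x => f x - g x).
Proof.
move=> [f1 f2] [g1 g2]; split.
  by under eq_fun do rewrite ReD ReN; exact: measurable_funB.
by under eq_fun do rewrite ImD ImN; exact: measurable_funB.
Qed.

Lemma cmeasurableM d (T : measurableType d) (f g : T -> R[i]) :
  cmeasurable f -> cmeasurable g -> cmeasurable (fun x => f x * g x).
Proof.
move=> [f1 f2] [g1 g2]; split.
  under eq_fun do rewrite ReM.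
  by apply: measurable_funB; apply: measurable_funM.
under eq_fun do rewrite ImM.
by apply: measurable_funD; apply: measurable_funM.
Qed.

Lemma cmeasurable_cst d (T : measurableType d) (c : R[i]) :
  cmeasurable (fun _ : T => c).
Proof. by split; exact: measurable_cst. Qed.

Lemma cmeasurable_conj f : cmeasurable f -> cmeasurable (fun x => (f x)^*%C).
Proof.
move=> [f1 f2]; split.
  by apply: eq_measurable_fun f1 => x _; case: (f x).
have : measurable_fun setT (fun x => - complex.Im (f x)) by exact: measurable_funN.
by apply: eq_measurable_fun => x _; case: (f x).
Qed.

Lemma measurable_sqr_cmod f : cmeasurable f ->
  measurable_fun setT (fun x => cmod (f x) ^+ 2).
Proof.
move=> [f1 f2]; under eq_fun do rewrite sqr_cmod.
by apply: measurable_funD; apply: measurable_funX.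
Qed.

Lemma cintegrableD f g : cintegrable f -> cintegrable g ->
  cintegrable (fun x => f x + g x).
Proof.
move=> [f1 f2] [g1 g2]; split.
  by under eq_fun do rewrite ReD EFinD; exact: integrableD.
by under eq_fun do rewrite ImD EFinD; exact: integrableD.
Qed.

Lemma cintegrableZ (c : R[i]) f : cintegrable f -> cintegrable (fun x => c * f x).
Proof.
move=> [f1 f2]; split.
  under eq_fun do rewrite ReM EFinB !EFinM.
  by apply: integrableB => //; exact: integrableZl.
under eq_fun do rewrite ImM EFinD !EFinM.
by apply: integrableD => //; exact: integrableZl.
Qed.

Lemma cintegralD f g : cintegrable f -> cintegrable g ->
  cintegral (fun x => f x + g x) = cintegral f + cintegral g.
Proof.
move=> [f1 f2] [g1 g2]; rewrite /cintegral.
under [X in Complex X _]eq_Rintegral do rewrite ReD.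
under [X in Complex _ X]eq_Rintegral do rewrite ImD.
by rewrite !RintegralD.
Qed.

Lemma cintegralZ (c : R[i]) f : cintegrable f ->
  cintegral (fun x => c * f x) = c * cintegral f.
Proof.
move=> [f1 f2]; rewrite /cintegral.
under [X in Complex X _]eq_Rintegral do rewrite ReM.
under [X in Complex _ X]eq_Rintegral do rewrite ImM.
have iZ (k : R) (h : R -> R) : mu.-integrable setT (EFin \o h) ->
    mu.-integrable setT (EFin \o (fun x => k * h x)).
  by move=> ih; apply: eq_integrable (integrableZl _ k ih).
rewrite RintegralB ?RintegralD ?RintegralZl//; try exact: iZ.
by case: c.
Qed.

Lemma cintegral_conj f : cintegrable f ->
  cintegral (fun x => (f x)^*%C) = (cintegral f)^*%C.
Proof.
move=> [f1 f2]; rewrite /cintegral /=; congr Complex.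
  by apply: eq_Rintegral => x _; case: (f x).
rewrite -mulN1r -RintegralZl//; apply: eq_Rintegral => x _.
by rewrite mulN1r; case: (f x).
Qed.

Lemma eq_cintegral f g : f =1 g -> cintegral f = cintegral g.
Proof. by move=> fg; congr cintegral; apply/funext. Qed.

(** ** Square-integrable functions *)

Lemma L2normE f : L2norm f =
  poweR (\int[mu]_x (cmod (f x) ^+ 2)%:E) 2^-1.
Proof.
rewrite /L2norm unlock; congr poweR; apply: eq_integral => x _.
by rewrite gee0_abs ?lee_fin ?cmod_ge0// poweR_EFin powR_mulrn ?cmod_ge0.
Qed.

Lemma L2E f : L2 f <-> cmeasurable f /\
  mu.-integrable setT (fun x => (cmod (f x) ^+ 2)%:E).
Proof.
rewrite /L2 L2normE; split => -[mf h]; split => //.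
  apply/integrableP; split.
    by apply/measurable_EFinP; exact: measurable_sqr_cmod.
  under eq_integral do rewrite gee0_abs ?lee_fin ?sqr_ge0//.
  by move: h; apply: lty_poweRy; rewrite invr_eq0.
move/integrableP: h => [_].
under eq_integral do rewrite gee0_abs ?lee_fin ?sqr_ge0//.
by move=> h; rewrite poweR_lty.
Qed.

Lemma cintegrable_le f (b : R -> R) : cmeasurable f ->
  mu.-integrable setT (fun x => (b x)%:E) -> (forall x, cmod (f x) <= b x) ->
  cintegrable f.
Proof.
move=> [f1 f2] ib fb; split; apply: le_integrable ib => //;
  try exact/measurable_EFinP.
  move=> x _; rewrite /= lee_fin (le_trans (norm_Re_le_cmod _))//.
  by rewrite (le_trans (fb x))// ler_norm.
move=> x _; rewrite /= lee_fin (le_trans (Im_le_cmod _))//.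
by rewrite (le_trans (fb x))// ler_norm.
Qed.

Lemma L2_cmeasurable f : L2 f -> cmeasurable f.
Proof. by case. Qed.

Lemma L2_sqr_integrable f : L2 f ->
  mu.-integrable setT (fun x => (cmod (f x) ^+ 2)%:E).
Proof. by move=> /L2E[]. Qed.

Lemma L2_integrableD f g : L2 f -> L2 g ->
  mu.-integrable setT (fun x => (cmod (f x) ^+ 2 + cmod (g x) ^+ 2)%:E).
Proof.
move=> /L2_sqr_integrable f2 /L2_sqr_integrable g2.
by under eq_fun do rewrite EFinD; exact: integrableD.
Qed.

Lemma L2_dominated f (b : R -> R) : cmeasurable f ->
  mu.-integrable setT (fun x => (b x)%:E) ->
  (forall x, cmod (f x) ^+ 2 <= b x) -> L2 f.
Proof.
move=> mf ib fb; apply/L2E; split => //; apply: le_integrable ib => //.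
  by apply/measurable_EFinP; exact: measurable_sqr_cmod.
move=> x _; rewrite /= lee_fin ger0_norm ?sqr_ge0// (le_trans (fb x))//.
exact: ler_norm.
Qed.

Lemma L2_mul_conj f g : L2 f -> L2 g -> cintegrable (fun x => f x * (g x)^*%C).
Proof.
move=> Lf Lg; apply: cintegrable_le (L2_integrableD Lf Lg) _.
  by apply: cmeasurableM (L2_cmeasurable Lf) (cmeasurable_conj (L2_cmeasurable Lg)).
move=> x; rewrite cmodM cmodJ.
have := cmod_ge0 (f x); have := cmod_ge0 (g x).
by move: (cmod (f x)) (cmod (g x)) => a b a0 b0; have := sqr_ge0 (a - b); nra.
Qed.

Lemma L2D f g : L2 f -> L2 g -> L2 (fun x => f x + g x).
Proof.
move=> Lf Lg; apply: (@L2_dominated _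
  (fun x => 2 * (cmod (f x) ^+ 2 + cmod (g x) ^+ 2))).
- exact: cmeasurableD (L2_cmeasurable Lf) (L2_cmeasurable Lg).
- under eq_fun do rewrite EFinM.
  by apply: integrableZl => //; exact: L2_integrableD.
move=> x; have h : cmod (f x + g x) ^+ 2 <= (cmod (f x) + cmod (g x)) ^+ 2.
  by rewrite ler_sqr ?nnegrE ?addr_ge0 ?cmod_ge0// cmodD.
rewrite (le_trans h)//; move: (cmod (f x)) (cmod (g x)) => a b.
by have := sqr_ge0 (a - b); nra.
Qed.

Lemma L2M f (h : R -> R[i]) (c : R) : cmeasurable h -> (forall x, cmod (h x) <= c) ->
  L2 f -> L2 (fun x => h x * f x).
Proof.
move=> mh hc Lf; apply: (@L2_dominated _ (fun x => c ^+ 2 * cmod (f x) ^+ 2)).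
- exact: cmeasurableM mh (L2_cmeasurable Lf).
- under eq_fun do rewrite EFinM.
  by apply: integrableZl => //; exact: L2_sqr_integrable.
move=> x; rewrite cmodM exprMn ler_wpM2r ?sqr_ge0//.
by rewrite ler_sqr ?nnegrE ?cmod_ge0// (le_trans _ (hc x))// cmod_ge0.
Qed.

Lemma L2Z f (c : R[i]) : L2 f -> L2 (fun x => c * f x).
Proof.
apply: (@L2M f (fun=> c) (cmod c)); last by move=> _; exact: lexx.
exact: cmeasurable_cst.
Qed.

Lemma L20 : L2 (fun _ : R => 0 : R[i]).
Proof.
apply: (@L2_dominated _ (fun=> 0)).
- exact: cmeasurable_cst.
- exact: integrable0.
by move=> x; rewrite cmod0 expr0n.
Qed.

End ComplexIntegral.

Definition L2pred (R : realType) : {pred R -> R[i]} := fun f => `[< L2 f >].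

Record L2fun (R : realType) := MkL2fun
  { L2val :> R -> R[i]; L2_asbool : L2pred L2val }.

Section L2Space.
Variable R : realType.
Local Notation mu := (@lebesgue_measure R).

HB.instance Definition _ := [isSub of L2fun R for @L2val R].
HB.instance Definition _ := [Choice of L2fun R by <:].

Lemma L2pred_submod : GRing.submod_closed (@L2pred R).
Proof.
split; first by apply/asboolP; exact: L20.
move=> c f g /asboolP Lf /asboolP Lg; apply/asboolP.
exact: (L2D (L2Z c Lf) Lg).
Qed.

HB.instance Definition _ :=
  GRing.isSubmodClosed.Build R[i] (R -> R[i]) (@L2pred R) L2pred_submod.
HB.instance Definition _ := [SubChoice_isSubLmodule of L2fun R by <:].

Lemma L2P (f : L2fun R) : L2 f.
Proof. by case: f => f h; exact/asboolP. Qed.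

Definition toL2 f (Lf : L2 f) : L2fun R := @MkL2fun R f (asboolT Lf).

Lemma L2valD (f g : L2fun R) x : (f + g) x = f x + g x.
Proof. by []. Qed.

Lemma L2valZ (c : R[i]) (f : L2fun R) x : (c *: f) x = c * f x.
Proof. by []. Qed.

Lemma L2valB (f g : L2fun R) x : (f - g) x = f x - g x.
Proof. by []. Qed.

Lemma L2val_sum (I : Type) (r : seq I) (F : I -> L2fun R) x :
  (\sum_(i <- r) F i) x = \sum_(i <- r) F i x.
Proof.
by elim: r => [|i r IH]; rewrite ?big_nil ?big_cons ?L2valD ?IH.
Qed.

Definition L2dot (f g : L2fun R) : R[i] := cintegral (fun x => f x * (g x)^*%C).

Lemma L2dot_semi_inner : semi_inner L2dot.
Proof.
split.
- move=> a f g h; rewrite /L2dot.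
  rewrite -cintegralZ; last exact: L2_mul_conj (L2P _) (L2P _).
  rewrite -cintegralD; first by apply: eq_cintegral => x; rewrite L2valD L2valZ; ring.
    by apply: cintegrableZ; exact: L2_mul_conj (L2P _) (L2P _).
  exact: L2_mul_conj (L2P _) (L2P _).
- move=> f g; rewrite /L2dot -cintegral_conj; last exact: L2_mul_conj (L2P _) (L2P _).
  by apply: eq_cintegral => x; rewrite rmorphM/= conjcK mulrC.
move=> f; apply: Rintegral_ge0 => x _.
by rewrite mulJc /= sqr_ge0.
Qed.

Lemma L2norm_nrm (f : L2fun R) : L2norm f = (nrm L2dot f)%:E.
Proof.
rewrite L2normE /nrm /nsq /L2dot /cintegral /=.
have -> : \int[mu]_x (complex.Re (f x * (f x)^*%C))%R =
    fine (\int[mu]_x (cmod (f x) ^+ 2)%:E).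
  by congr fine; apply: eq_integral => x _; rewrite mulJc.
have fi : (\int[mu]_x (cmod (f x) ^+ 2)%:E)%E \is a fin_num.
  by apply: integrable_fin_num => //; exact: L2_sqr_integrable (L2P f).
rewrite -{1}(fineK fi) poweR_EFin powR12_sqrt// fine_ge0// integral_ge0// => x _.
by rewrite lee_fin sqr_ge0.
Qed.

End L2Space.


(** * Multipliers on the space of square-integrable functions *)

Section L2Multipliers.
Variable R : realType.
Local Notation mu := (@lebesgue_measure R).
Local Notation nrm := (nrm (@L2dot R)).
Local Notation dot := (@L2dot R).
Local Notation V := (L2fun R).
Let dotP := @L2dot_semi_inner R.

Lemma ae_imply (P Q : R -> Prop) : (forall x, P x -> Q x) ->
  {ae mu, forall x, P x} -> {ae mu, forall x, Q x}.
Proof. by move=> PQ; apply: negligibleS => x /= nQ /PQ. Qed.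

Lemma ae_forall (P : R -> Prop) : (forall x, P x) -> {ae mu, forall x, P x}.
Proof. by move=> hP; apply: negligibleS (negligible_set0 mu) => x /= /(_ (hP x)). Qed.

Lemma ae_and (P Q : R -> Prop) : {ae mu, forall x, P x} ->
  {ae mu, forall x, Q x} -> {ae mu, forall x, P x /\ Q x}.
Proof.
move=> hP hQ; apply: negligibleS (negligibleU hP hQ) => x /= nPQ.
by have [p|np] := pselect (P x); [right => q; apply: nPQ|left].
Qed.

Lemma measurable_sqr_L2 (F : V) :
  measurable_fun setT (fun x => (cmod (F x) ^+ 2)%:E).
Proof.
apply/measurable_EFinP; apply: measurable_sqr_cmod.
exact: L2_cmeasurable (L2P F).
Qed.

Lemma nsq_integral (F : V) : (nsq dot F)%:E = (\int[mu]_x (cmod (F x) ^+ 2)%:E)%E.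
Proof.
rewrite -[RHS]fineK; last first.
  by apply: integrable_fin_num => //; exact: L2_sqr_integrable (L2P F).
by congr (fine _)%:E; apply: eq_integral => x _; rewrite mulJc.
Qed.

Lemma nrm_dominated (F G : V) (c : R) : 0 <= c ->
  (forall x, cmod (F x) <= c * cmod (G x)) -> nrm F <= c * nrm G.
Proof.
move=> c0 FG; rewrite -ler_sqr ?nnegrE ?mulr_ge0 ?nrm_ge0// exprMn.
rewrite !(sqr_nrm dotP) -lee_fin EFinM !nsq_integral.
rewrite -ge0_integralZl//; last 3 first.
- exact: measurable_sqr_L2.
- by move=> x _; rewrite lee_fin sqr_ge0.
- by rewrite lee_fin sqr_ge0.
apply: ge0_le_integral => //.
- by move=> x _; rewrite lee_fin sqr_ge0.
- exact: measurable_sqr_L2.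
- by apply: measurable_funeM; exact: measurable_sqr_L2.
move=> x _; rewrite -EFinM lee_fin -exprMn.
by rewrite ler_sqr ?nnegrE ?mulr_ge0 ?cmod_ge0.
Qed.

Lemma nrm_ae0 (F : V) : {ae mu, forall x, F x = 0} -> nrm F = 0.
Proof.
move=> F0; suff F2 : nsq dot F = 0 by rewrite /nrm F2 sqrtr0.
apply: EFin_inj; rewrite nsq_integral.
have -> : 0%:E = (\int[mu]_x (cst 0%E x))%E :> \bar R by rewrite integral0.
apply: ge0_ae_eq_integral => //.
- exact: measurable_sqr_L2.
- by move=> x _; rewrite lee_fin sqr_ge0.
by apply: ae_imply F0 => x Fx _; rewrite Fx cmod0 expr0n.
Qed.

Lemma cmod_cvg (F : nat -> R[i]) (h : R[i]) :
  (forall e, 0 < e -> exists N, forall n, (N <= n)%N -> cmod (F n - h) <= e) ->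
  (cmod (F n) ^+ 2)%:E @[n --> \oo] --> (cmod h ^+ 2)%:E.
Proof.
move=> H; apply: cvg_EFin; first exact: nearW.
have c : cmod (F n) @[n --> \oo] --> cmod h.
  apply/cvgrPdist_le => e e0; have [N hN] := H _ e0.
  near=> n; have nN : (N <= n)%N by near: n; exact: nbhs_infty_ge.
  rewrite (le_trans _ (hN n nN))//.
  have h1 := cmodD (F n - h) h; rewrite subrK in h1.
  have h2 := cmodD (h - F n) (F n); rewrite subrK -opprB cmodN in h2.
  by rewrite ler_norml; apply/andP; split; lra.
by rewrite expr2; under eq_fun do rewrite expr2; exact: cvgM.
Unshelve. all: by end_near.
Qed.

Lemma L2_fatou (F : nat -> V) (h : R -> R[i]) (C : R) : 0 <= C -> cmeasurable h ->
  {ae mu, forall x, forall e, 0 < e ->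
     exists N, forall n, (N <= n)%N -> cmod (F n x - h x) <= e} ->
  (forall n, nrm (F n) <= C) -> L2 h /\ (L2norm h <= C%:E)%E.
Proof.
move=> C0 mh [N [mN N0 subN]] FC.
have mh2 : measurable_fun setT (fun x => (cmod (h x) ^+ 2)%:E).
  by apply/measurable_EFinP; exact: measurable_sqr_cmod.
have IC n : (\int[mu]_x (cmod (F n x) ^+ 2)%:E <= (C ^+ 2)%:E)%E.
  rewrite -nsq_integral lee_fin -(sqr_nrm dotP).
  by rewrite ler_sqr ?nnegrE ?nrm_ge0.
have hC : (\int[mu]_x (cmod (h x) ^+ 2)%:E <= (C ^+ 2)%:E)%E.
  rewrite (ge0_negligible_integral mN)//; last first.
    by move=> x _; rewrite lee_fin sqr_ge0.
  rewrite setTD.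
  have mD : measurable (~` N) by exact: measurableC.
  have H := @fatou _ _ _ mu _ mD (fun n x => (cmod (F n x) ^+ 2)%:E)
    (fun n => measurable_funTS (@measurable_sqr_L2 (F n)))
    (fun n x _ => sqr_ge0 _).
  have -> : (\int[mu]_(x in ~` N) (cmod (h x) ^+ 2)%:E =
      \int[mu]_(x in ~` N) limn_einf (fun n => (cmod (F n x) ^+ 2)%:E))%E.
    apply: eq_integral => x; rewrite inE => xN.
    have xc : (cmod (F n x) ^+ 2)%:E @[n --> \oo] --> (cmod (h x) ^+ 2)%:E.
      by apply: cmod_cvg; apply: contrapT => nx; apply: xN; exact: subN.
    rewrite is_cvg_limn_einfE; first exact/esym/cvg_lim.
    by apply/cvg_ex; eexists; exact: xc.
  rewrite (le_trans H)// limn_einf_lim; apply: lime_le; first exact: is_cvg_einfs.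
  apply: nearW => n; apply: (@le_trans _ _ (\int[mu]_(x in ~` N) (cmod (F n x) ^+ 2)%:E)%E).
    by apply: ereal_inf_lbound; exists n => /=.
  rewrite (le_trans _ (IC n))//; apply: ge0_subset_integral => //.
    exact: measurable_sqr_L2.
  by move=> x _; rewrite lee_fin sqr_ge0.
have Lh : L2 h.
  apply/L2E; split => //; apply/integrableP; split => //.
  under eq_integral do rewrite gee0_abs ?lee_fin ?sqr_ge0//.
  by rewrite (le_lt_trans hC)// ltry.
split => //; rewrite -[h]/(toL2 Lh : R -> R[i]) L2norm_nrm lee_fin.
rewrite -ler_sqr ?nnegrE ?nrm_ge0// (sqr_nrm dotP) -lee_fin.
by rewrite nsq_integral.
Qed.

End L2Multipliers.

(** * Step functions of the larger variable *)

Section StepMultipliers.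
Variable R : realType.
Local Notation mu := (@lebesgue_measure R).
Local Notation nrm := (nrm (@L2dot R)).
Local Notation dot := (@L2dot R).
Local Notation V := (L2fun R).
Let dotP := @L2dot_semi_inner R.

Definition initial_segment (A : set R) : Prop := forall x y, x <= y -> A y -> A x.

Lemma initial_segment_measurable A : initial_segment A -> measurable A.
Proof.
move=> iA; apply: is_interval_measurable => x y _ Ay z /andP[_ zy].
exact: iA Ay.
Qed.

Definition cindic (A : set R) (x : R) : R[i] := (\1_A x)%:C.

Lemma cmod_cindic A x : cmod (cindic A x) <= 1.
Proof. by rewrite cmodR indicE; case: (_ \in _); rewrite ?normr1 ?normr0. Qed.

Lemma cindic_conj A x : (cindic A x)^*%C = cindic A x.
Proof. exact: conjc_real. Qed.

Lemma cindic_sub A B x : A `<=` B -> cindic A x * cindic B x = cindic A x.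
Proof.
move=> AB; rewrite /cindic -rmorphM !indicE.
have [xA|] := boolP (x \in A); last by rewrite mul0r.
by rewrite mem_set ?mulr1//; apply: AB; rewrite inE in xA.
Qed.

Lemma cindic_max A x y : initial_segment A ->
  cindic A (Num.max x y) = cindic A x * cindic A y.
Proof.
move=> iA; wlog xy : x y / x <= y.
  move=> h; have [xy|/ltW yx] := leP x y; first by have := h _ _ xy; rewrite max_r.
  by have := h _ _ yx; rewrite max_r// mulrC.
rewrite max_r// /cindic -rmorphM !indicE.
have [yA|] := boolP (y \in A); last by rewrite mulr0.
by rewrite mem_set ?mulr1//; apply: iA xy _; rewrite inE in yA.
Qed.

Lemma cmeasurable_cindic A : measurable A -> cmeasurable (cindic A).
Proof.
move=> mA; split; last exact: measurable_cst.
exact: (measurable_indic mA).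
Qed.

Definition restr (A : set R) (mA : measurable A) (f : V) : V :=
  toL2 (L2M (cmeasurable_cindic mA) (cmod_cindic A) (L2P f)).

Lemma L2fun_ext (f g : V) : (forall x, f x = g x) -> f = g.
Proof. by move=> fg; apply: val_inj; apply/funext. Qed.

Lemma cintegrable_mul_bounded (g h : R -> R[i]) (c : R) : cmeasurable g ->
  (forall x, cmod (g x) <= c) -> cintegrable h -> cintegrable (fun x => g x * h x).
Proof.
move=> mg gc [h1 h2].
have mh : cmeasurable h.
  by split; apply/measurable_EFinP; [case/integrableP: h1|case/integrableP: h2].
apply: (@cintegrable_le _ _
  (fun x => c * (`|complex.Re (h x)| + `|complex.Im (h x)|))).
- exact: cmeasurableM.
- under eq_fun do rewrite EFinM EFinD.
  apply: integrableZl => //; apply: integrableD => //.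
    exact: (integrable_norm h1).
  exact: (integrable_norm h2).
by move=> x; rewrite cmodM ler_pM ?cmod_ge0// cmod_le_ReIm.
Qed.

Lemma cintegral_sum (I : Type) (r : seq I) (F : I -> R -> R[i]) :
  (forall i, cintegrable (F i)) ->
  cintegrable (fun x => \sum_(i <- r) F i x) /\
  cintegral (fun x => \sum_(i <- r) F i x) = \sum_(i <- r) cintegral (F i).
Proof.
move=> iF; elim: r => [|i r [IH1 IH2]].
  have e : (fun x : R => \sum_(i <- [::]) F i x) = fun=> 0.
    by apply/funext => x; rewrite big_nil.
  rewrite e big_nil; split; first by split; exact: integrable0.
  by rewrite /cintegral /= /Rintegral integral0.
have e : (fun x => \sum_(j <- i :: r) F j x) =
    fun x => F i x + \sum_(j <- r) F j x.
  by apply/funext => x; rewrite big_cons.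
rewrite e big_cons -IH2; split; first exact: cintegrableD.
exact: cintegralD.
Qed.

Lemma cmod_cintegral_le (g : R -> R[i]) (b : R -> R) : cmeasurable g ->
  mu.-integrable setT (fun x => (b x)%:E) -> (forall x, cmod (g x) <= b x) ->
  cmod (cintegral g) <= 2 * Rintegral mu setT b.
Proof.
move=> mg ib gb; have [g1 g2] := cintegrable_le mg ib gb.
have le1 (h : R -> R) : mu.-integrable setT (fun x => (h x)%:E) ->
    (forall x, `|h x| <= b x) -> `|Rintegral mu setT h| <= Rintegral mu setT b.
  move=> ih hb; rewrite (le_trans (le_normr_Rintegral _ _))//.
  by apply: le_Rintegral => //; exact: (integrable_norm ih).
have h1 := le1 _ g1 (fun x => le_trans (norm_Re_le_cmod _) (gb x)).
have h2 := le1 _ g2 (fun x => le_trans (Im_le_cmod _) (gb x)).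
rewrite (complexE (cintegral g)) (le_trans (cmodD _ _))// cmodM !cmodR.
have -> : cmod 'i%C = 1 :> R by rewrite cmodE /= expr0n expr1n add0r sqrtr1.
by rewrite mul1r mulr_natl mulr2n lerD.
Qed.

Section Step.
Variables (q : nat) (A : 'I_q -> set R) (c : 'I_q -> R[i]).
Hypothesis iA : forall t, initial_segment (A t).

Let mA t := initial_segment_measurable (@iA t).
Definition step_proj (t : 'I_q) : V -> V := restr (mA t).
Definition step_symbol (x : R) : R[i] := \sum_t c t * cindic (A t) x.

Lemma initial_segment_total (B C : set R) :
  initial_segment B -> initial_segment C -> B `<=` C \/ C `<=` B.
Proof.
move=> iB iC; have [|/existsNP[x /not_implyP[Bx nCx]]] := pselect (B `<=` C).
  by left.
right => y Cy; have [xy|yx] := leP x y; first by case: nCx; exact: iC Cy.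
exact: iB (ltW yx) Bx.
Qed.

Lemma step_proj_chain : proj_chain dot step_proj.
Proof.
split.
- move=> t a x y; apply: L2fun_ext => u.
  by rewrite L2valD L2valZ /= mulrDr mulrCA.
- move=> t x y; apply: eq_cintegral => u /=.
  by rewrite rmorphM [X in x u * (X * _)]cindic_conj; ring.
move=> s t; have [st|ts] := initial_segment_total (@iA s) (@iA t).
  left => x; split; apply: L2fun_ext => u /=; rewrite mulrA.
    by rewrite (cindic_sub _ st).
  by rewrite [cindic (A t) u * _]mulrC (cindic_sub _ st).
right => x; split; apply: L2fun_ext => u /=; rewrite mulrA.
  by rewrite [cindic (A s) u * _]mulrC (cindic_sub _ ts).
by rewrite (cindic_sub _ ts).
Qed.

Lemma cmeasurable_step_symbol : cmeasurable step_symbol.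
Proof.
rewrite /step_symbol; elim: (index_enum _) => [|t r IH].
  under eq_fun do rewrite big_nil; exact: cmeasurable_cst.
under eq_fun do rewrite big_cons; apply: cmeasurableD IH.
by apply: cmeasurableM; [exact: cmeasurable_cst|exact: cmeasurable_cindic].
Qed.

Lemma step_symbol_max x y : step_symbol (Num.max x y) =
  \sum_t (c t * cindic (A t) x) * cindic (A t) y.
Proof. by apply: eq_bigr => t _; rewrite cindic_max// mulrA. Qed.

(** Off the null set where the kernel fails to be integrable against f, the
    finite sum over t can be taken inside the integral. *)
Lemma chain_mult_kernel (k : R * R -> R[i]) (T : V -> V) (f : V) (x : R) :
  (forall g : V, T g x = kernel_operator k g x) ->
  cintegrable (fun y => k (x, y) * f y) ->
  chain_mult step_proj c T f x =
  cintegral (fun y => step_symbol (Num.max x y) * (k (x, y) * f y)).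
Proof.
move=> Tk ik; rewrite L2val_sum.
have iI t : cintegrable (fun y => cindic (A t) y * (k (x, y) * f y)).
  exact: (cintegrable_mul_bounded (cmeasurable_cindic (mA t)) (cmod_cindic (A t)) ik).
rewrite (eq_bigr (fun t => cintegral (fun y => (c t * cindic (A t) x) *
    (cindic (A t) y * (k (x, y) * f y))))); last first.
  move=> t _; rewrite cintegralZ// L2valZ /= Tk mulrA; congr (_ * _).
  by apply: eq_cintegral => y /=; ring.
rewrite -(cintegral_sum _ (fun t => cintegrableZ _ (iI t))).2.
apply: eq_cintegral => y; rewrite step_symbol_max mulr_suml.
by apply: eq_bigr => t _; rewrite !mulrA.
Qed.

End Step.

(** On an operator of finite rank the multiplier depends continuously on the
    sup norm of its symbol; on all bounded operators only the total variation
    controls it. *)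
Lemma chain_mult_rank1_close (u v : V) q (A : 'I_q -> set R) (c : 'I_q -> R[i])
    (iA : forall t, initial_segment (A t))
    q' (A' : 'I_q' -> set R) (c' : 'I_q' -> R[i])
    (iA' : forall t, initial_segment (A' t)) (e : R) : 0 <= e ->
  (forall x, cmod (step_symbol A c x - step_symbol A' c' x) <= e) ->
  forall f, nrm (chain_mult (step_proj iA) c (fun f => dot f v *: u) f -
                 chain_mult (step_proj iA') c' (fun f => dot f v *: u) f) <=
    nrm u * nrm v * e * nrm f.
Proof.
move=> e0 close f.
pose G x : V := \sum_t (c t * cindic (A t) x) *: step_proj iA t f -
  \sum_t (c' t * cindic (A' t) x) *: step_proj iA' t f.
have GE x y : G x y =
    (step_symbol A c (Num.max x y) - step_symbol A' c' (Num.max x y)) * f y.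
  rewrite !step_symbol_max// L2valB !L2val_sum mulrBl !mulr_suml.
  by congr (_ - _); apply: eq_bigr => t _; rewrite L2valZ /= mulrA.
have Gn x : nrm (G x) <= e * nrm f.
  by apply: nrm_dominated => // y; rewrite GE cmodM ler_wpM2r ?cmod_ge0.
have expand q0 (A0 : 'I_q0 -> set R) (c0 : 'I_q0 -> R[i])
    (i0 : forall t, initial_segment (A0 t)) x :
    chain_mult (step_proj i0) c0 (fun f => dot f v *: u) f x =
    dot (\sum_t (c0 t * cindic (A0 t) x) *: step_proj i0 t f) v * u x.
  rewrite L2val_sum (dot_suml dotP) mulr_suml; apply: eq_bigr => t _.
  rewrite (dotZl dotP) L2valZ /= mulrA -[RHS]mulrA; congr (_ * _).
rewrite (_ : nrm u * _ * _ * _ = (e * nrm f * nrm v) * nrm u); last by ring.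
apply: nrm_dominated; first by rewrite !mulr_ge0 ?nrm_ge0.
move=> x; rewrite L2valB !expand -mulrBl -(dotBl dotP) -/(G x) cmodM.
rewrite ler_wpM2r ?cmod_ge0// (le_trans (cauchy_schwarz dotP _ _))//.
by rewrite ler_wpM2r ?nrm_ge0.
Qed.

Lemma chain_mult_ftens q (P : 'I_q -> V -> V) (c : 'I_q -> R[i]) s f :
  proj_chain dot P ->
  chain_mult P c (ftens dot s) f =
  \sum_(p <- s) chain_mult P c (fun f => dot f p.2 *: p.1) f.
Proof.
move=> PP; rewrite /chain_mult exchange_big /=; apply: eq_bigr => t _.
rewrite /ftens (big_morph (P t) (chain_projD PP t) (chain_proj0 PP t)).
by rewrite scaler_sumr.
Qed.

Lemma chain_mult_tensor_close (s : seq (V * V)) q (A : 'I_q -> set R)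
    (c : 'I_q -> R[i]) (iA : forall t, initial_segment (A t))
    q' (A' : 'I_q' -> set R) (c' : 'I_q' -> R[i])
    (iA' : forall t, initial_segment (A' t)) (e : R) : 0 <= e ->
  (forall x, cmod (step_symbol A c x - step_symbol A' c' x) <= e) ->
  forall f, nrm (chain_mult (step_proj iA) c (ftens dot s) f -
                 chain_mult (step_proj iA') c' (ftens dot s) f) <=
    (\sum_(p <- s) nrm p.1 * nrm p.2) * e * nrm f.
Proof.
move=> e0 close f.
rewrite !chain_mult_ftens; try exact: step_proj_chain.
rewrite -sumrB (le_trans (nrm_sum dotP _ _))// !mulr_suml ler_sum// => p _.
exact: chain_mult_rank1_close.
Qed.

End StepMultipliers.

(** * Functions of bounded variation *)

Section BoundedVariation.
Variable R : realType.
Implicit Types (psi : R -> R[i]) (g : R -> R).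

Fixpoint vsum psi (a : R) (s : seq R) : R :=
  if s is x :: s' then cmod (psi x - psi a) + vsum psi x s' else 0.

Lemma vsumE psi (a b : R) (s : seq R) :
  \sum_(0 <= n < size s)
    cmod (psi (nth b (a :: s) n.+1) - psi (nth b (a :: s) n)) = vsum psi a s.
Proof.
elim: s a => [|x s IH] a /=; first by rewrite big_geq.
by rewrite big_nat_recl//= -IH.
Qed.

Lemma vsum_rcons psi a s y :
  vsum psi a (rcons s y) = vsum psi a s + cmod (psi y - psi (last a s)).
Proof. by elim: s a => [|x s IH] a /=; rewrite ?addr0 ?add0r// IH addrA. Qed.

(** v x is the supremum of the variation sums over partitions ending at x;
    appending y to such a partition gives the increment. *)
Lemma variation_function psi : bounded_variation_line psi ->
  exists (v : R -> R) (M : R), (forall x, 0 <= v x <= M) /\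
    forall x y, x <= y -> cmod (psi y - psi x) <= v y - v x.
Proof.
move=> [M hM]; pose S x := [set vsum psi p.1 p.2 | p in
  [set p : R * seq R | path <%R p.1 p.2 /\ last p.1 p.2 = x]].
have SM x : has_ubound (S x).
  exists M => _ [[a s] /= [ps ls] <-]; rewrite -(vsumE psi a x).
  by apply: hM; split => //; apply/eqP.
have S0 x : S x 0 by exists (x, [::]).
pose v x := sup (S x); exists v, M; split.
  move=> x; rewrite ub_le_sup//= ge_sup//; first by exists 0.
  move=> _ [[a s] /= [ps ls] <-]; rewrite -(vsumE psi a x).
  by apply: hM; split => //; apply/eqP.
move=> x y; rewrite le_eqVlt => /predU1P[->|xy]; first by rewrite !subrr cmod0.
rewrite lerBrDr addrC -lerBrDr; apply: ge_sup; first by exists 0.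
move=> _ [[a s] /= [ps ls] <-]; rewrite lerBrDr -ls -vsum_rcons.
apply: ub_le_sup => //; exists (a, rcons s y) => //=; split.
  by rewrite rcons_path ps ls.
by rewrite last_rcons.
Qed.

(** The l^1 bound M on the coefficients stands for the total variation: it
    controls the multiplier on all bounded operators. *)
Definition stepwise (M : R) psi : Prop := forall e : R, 0 < e ->
  exists q (A : 'I_q -> set R) (c : 'I_q -> R[i]),
    [/\ forall t, initial_segment (A t), \sum_t cmod (c t) <= M
      & forall x, cmod (psi x - step_symbol A c x) <= e].

Lemma stepwiseD M M' psi psi' : stepwise M psi -> stepwise M' psi' ->
  stepwise (M + M') (fun x => psi x + psi' x).
Proof.
move=> h h' e e0; have e20 : 0 < e / 2 by rewrite divr_gt0.
have [q [A [c [iA cM hA]]]] := h _ e20.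
have [q' [A' [c' [iA' cM' hA']]]] := h' _ e20.
pose B t := match fintype.split t with inl i => A i | inr j => A' j end.
pose d t := match fintype.split t with inl i => c i | inr j => c' j end.
exists (q + q')%N, B, d.
have Bl i : B (lshift q' i) = A i by rewrite /B (unsplitK (inl i)).
have Br i : B (rshift q i) = A' i by rewrite /B (unsplitK (inr i)).
have dl i : d (lshift q' i) = c i by rewrite /d (unsplitK (inl i)).
have dr i : d (rshift q i) = c' i by rewrite /d (unsplitK (inr i)).
split.
- by move=> t; rewrite /B; case: (fintype.split t).
- rewrite big_split_ord /=.
  under eq_bigr do rewrite dl.
  by under [X in _ + X <= _]eq_bigr do rewrite dr; rewrite lerD.
move=> x; rewrite /step_symbol big_split_ord /=.
under eq_bigr do rewrite dl Bl.
under [X in _ - (_ + X)]eq_bigr do rewrite dr Br.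
rewrite opprD addrACA (le_trans (cmodD _ _))// (splitr e).
by rewrite lerD ?hA ?hA'.
Qed.

Lemma stepwiseZ M psi (a : R[i]) : stepwise M psi ->
  stepwise (cmod a * M) (fun x => a * psi x).
Proof.
move=> h e e0; have a0 : 0 < cmod a + 1 by rewrite ltr_pwDr ?cmod_ge0.
have [q [A [c [iA cM hA]]]] := h _ (divr_gt0 e0 a0).
exists q, A, (fun t => a * c t); split => //.
  rewrite (eq_bigr (fun t => cmod a * cmod (c t))); last by move=> t _; exact: cmodM.
  by rewrite -mulr_sumr ler_wpM2l ?cmod_ge0.
move=> x; have -> : step_symbol A (fun t => a * c t) x = a * step_symbol A c x.
  by rewrite /step_symbol mulr_sumr; apply: eq_bigr => t _; rewrite mulrA.
rewrite -mulrBr cmodM (le_trans (ler_wpM2l (cmod_ge0 _) (hA x)))//.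
by rewrite mulrCA ler_piMr ?(ltW e0)// ler_pdivrMr// mul1r lerDl.
Qed.

Lemma count_ge (m K : nat) : (\sum_(i < K) (m <= i) = K - m)%N.
Proof. by elim: K => [|K IH]; rewrite ?big_ord0// big_ord_recr /= IH; lia. Qed.

(** Rounding g + M down to a multiple of 1/n counts the thresholds j/n it has
    passed; each threshold is an initial segment with coefficient -1/n. *)
Lemma stepwise_monotone g (M : R) : (forall x y, x <= y -> g x <= g y) ->
  (forall x, `|g x| <= M) -> stepwise (5 * M + 2) (fun x => (g x)%:C).
Proof.
move=> gmono gM e e0.
have M0 : 0 <= M by rewrite (le_trans _ (gM 0)).
pose n := (Num.truncn e^-1).+1.
have n0 : 0 < n%:R :> R by rewrite ltr0n.
have ne : n%:R^-1 <= e.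
  rewrite -[leRHS]invrK lef_pV2 ?posrE ?invr_gt0//.
  have ei : 0 <= e^-1 by rewrite invr_ge0 ltW.
  by have /andP[_ h] := Num.Theory.truncn_itv ei; exact: ltW.
pose h x := n%:R * (g x + M).
have h0 x : 0 <= h x.
  rewrite mulr_ge0 ?(ltW n0)//; have := gM x; rewrite ler_norml => /andP[+ _].
  by rewrite -lerBlDr sub0r.
have hM x : h x <= n%:R * (2 * M).
  rewrite ler_wpM2l ?(ltW n0)//; have := gM x; rewrite ler_norml => /andP[_].
  by rewrite mulr_natl mulr2n lerD2r.
pose K := Num.truncn (n%:R * (2 * M)).
have hK x : (Num.truncn (h x) <= K)%N by exact: Num.Theory.le_truncn.
have KM : K%:R / n%:R <= 2 * M.
  rewrite ler_pdivrMr// mulrC.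
  by have /andP[] := Num.Theory.truncn_itv (mulr_ge0 (ltW n0) (mulr_ge0 (ler0n R 2) M0)).
(* index 0 carries the constant, index j + 1 the threshold (j + 1) / n *)
pose A (t : 'I_K.+1) : set R :=
  if unlift ord0 t is Some j then [set x | h x < j.+1%:R] else setT.
pose c (t : 'I_K.+1) : R[i] :=
  if unlift ord0 t is Some j then (- n%:R^-1)%:C else (K%:R / n%:R - M)%:C.
exists K.+1, A, c; split.
- move=> t x y xy; rewrite /A; case: (unlift _ t) => // j /=; apply: le_lt_trans.
  by rewrite /h ler_wpM2l ?(ltW n0)// lerD2r gmono.
- rewrite big_ord_recl /c unlift_none.
  under eq_bigr do rewrite liftK cmodR normrN ger0_norm ?invr_ge0 ?ler0n//.
  rewrite sumr_const card_ord cmodR -[X in _ + X]mulr_natl.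
  have r0 : 0 <= K%:R / n%:R :> R by rewrite divr_ge0 ?ler0n.
  move: (K%:R / n%:R) KM r0 => r rM r0.
  have : `|r - M| <= r + M.
    by rewrite (le_trans (ler_normB _ _))// !ger0_norm.
  by lra.
move=> x; have -> : step_symbol A c x = ((Num.truncn (h x))%:R / n%:R - M)%:C.
  rewrite /step_symbol big_ord_recl {1}/c {1}/A unlift_none.
  rewrite (eq_bigr (fun i : 'I_K => (- n%:R^-1 * (Num.truncn (h x) <= i)%N%:R)%:C)).
    rewrite -rmorph_sum /= -mulr_sumr -natr_sum count_ge natrB//.
    rewrite /cindic indicT mulr1 -rmorphD /=; congr (_ %:C).
    by field; rewrite gt_eqF.
  move=> i _; rewrite /c /A liftK /cindic -rmorphM /=; congr (_ * _)%:C.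
  rewrite indicE; congr (nat_of_bool _)%:R.
  apply/idP/idP; rewrite inE /=.
    move=> hi; have /andP[h1 _] := Num.Theory.truncn_itv (h0 x).
    by rewrite -ltnS -(ltr_nat R) (le_lt_trans h1).
  move=> ti; have /andP[_ h2] := Num.Theory.truncn_itv (h0 x).
  by rewrite (lt_le_trans h2)// ler_nat ltnS.
rewrite -rmorphB cmodR (le_trans _ ne)//.
have /andP[h1 h2] := Num.Theory.truncn_itv (h0 x).
have gE : g x = h x / n%:R - M by rewrite /h mulrC mulKf ?gt_eqF// addrK.
rewrite gE (_ : _ - _ = (h x - (Num.truncn (h x))%:R) / n%:R); last by ring.
have d0 : 0 <= h x - (Num.truncn (h x))%:R by rewrite subr_ge0.
rewrite ger0_norm ?divr_ge0 ?(ltW n0)// ler_piMl ?invr_ge0 ?(ltW n0)//.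
by rewrite lerBlDl natr1 ltW.
Qed.

(** psi is a combination of the nondecreasing functions v, v - Re psi and
    v - Im psi, where v is the variation function. *)
Lemma bounded_variation_stepwise psi : bounded_variation_line psi ->
  (exists M, stepwise M psi) /\ cmeasurable psi.
Proof.
move=> /variation_function[v [M [vM hv]]].
pose g1 x := v x - complex.Re (psi x).
pose g2 x := v x - complex.Im (psi x).
have vmono x y : x <= y -> v x <= v y.
  by move=> xy; rewrite -subr_ge0 (le_trans _ (hv _ _ xy))// cmod_ge0.
have g1mono x y : x <= y -> g1 x <= g1 y.
  move=> xy; have := hv _ _ xy; have := norm_Re_le_cmod (psi y - psi x).
  by rewrite ReD ReN ler_norml /g1 => /andP[_ h1] h2; lra.
have g2mono x y : x <= y -> g2 x <= g2 y.
  move=> xy; have := hv _ _ xy; have := Im_le_cmod (psi y - psi x).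
  by rewrite ImD ImN ler_norml /g2 => /andP[_ h1] h2; lra.
have M0 : 0 <= M by have /andP[h1 h2] := vM 0; exact: le_trans h1 h2.
have psiB x : cmod (psi x - psi 0) <= M.
  have [x0|/ltW x0] := leP x 0.
    rewrite -cmodN opprB (le_trans (hv _ _ x0))//.
    by have /andP[_ h1] := vM 0; have /andP[h2 _] := vM x; lra.
  rewrite (le_trans (hv _ _ x0))//.
  by have /andP[h1 _] := vM 0; have /andP[_ h2] := vM x; lra.
pose B := 2 * M + cmod (psi 0).
have psiM x : cmod (psi x) <= M + cmod (psi 0).
  by rewrite -[psi x](subrK (psi 0)) (le_trans (cmodD _ _))// lerD2r.
have vB x : `|v x| <= B.
  have /andP[h1 h2] := vM x; rewrite ger0_norm//.
  by have := cmod_ge0 (psi 0); rewrite /B; lra.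
have g1B x : `|g1 x| <= B.
  have /andP[h1 h2] := vM x; rewrite (le_trans (ler_normB _ _))// ger0_norm//.
  have := norm_Re_le_cmod (psi x); have := psiM x; rewrite /B; lra.
have g2B x : `|g2 x| <= B.
  have /andP[h1 h2] := vM x; rewrite (le_trans (ler_normB _ _))// ger0_norm//.
  have := Im_le_cmod (psi x); have := psiM x; rewrite /B; lra.
split.
  have sv := stepwise_monotone vmono vB.
  have s1 := stepwise_monotone g1mono g1B.
  have s2 := stepwise_monotone g2mono g2B.
  have := stepwiseD (stepwiseZ (1 +i* 1) sv)
    (stepwiseD (stepwiseZ (- 1) s1) (stepwiseZ (0 -i* 1) s2)).
  set N := _ + _ => h; exists N; move: h; congr stepwise; apply/funext => x.
  rewrite /g1 /g2; case: (psi x) => a b.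
  by apply/eqP; rewrite eq_complex /=; apply/andP; split; apply/eqP; ring.
have mv := nondecreasing_measurable measurableT vmono.
have m1 := nondecreasing_measurable measurableT g1mono.
have m2 := nondecreasing_measurable measurableT g2mono.
split.
  rewrite (_ : (fun x => _) = v \- g1); first exact: measurable_funB.
  by apply/funext => x /=; rewrite /g1 subKr.
rewrite (_ : (fun x => _) = v \- g2); first exact: measurable_funB.
by apply/funext => x /=; rewrite /g2 subKr.
Qed.

End BoundedVariation.

(** * Singular numbers *)

Section SingularNumbers.
Variable R : realType.
Local Notation mu := (@lebesgue_measure R).
Local Notation nrm := (nrm (@L2dot R)).
Local Notation dot := (@L2dot R).
Local Notation V := (L2fun R).
Let dotP := @L2dot_semi_inner R.
Implicit Types T S : (R -> R[i]) -> (R -> R[i]).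

Definition lift T (hT : forall f, L2 f -> L2 (T f)) (f : V) : V :=
  toL2 (hT f (L2P f)).

Definition ae_linear T : Prop := forall (c : R[i]) f g, L2 f -> L2 g ->
  {ae mu, forall x, T (fun t => c * f t + g t) x = c * T f x + T g x}.

Lemma lift_linear T (hT : forall f, L2 f -> L2 (T f)) : ae_linear T ->
  forall a x y, nrm (lift hT (a *: x + y) - (a *: lift hT x + lift hT y)) = 0.
Proof.
move=> lin a x y; apply: nrm_ae0; apply: ae_imply (lin a x y (L2P x) (L2P y)) => u h.
by apply/eqP; rewrite subr_eq0; apply/eqP; exact: h.
Qed.

(** Homogeneity extends the bound from the unit ball; on a null vector, all of
    whose multiples are in the unit ball, it forces the image to be null. *)
Lemma null_linear_bound (S : V -> V) (c : R) :
  (forall a x y, nrm (S (a *: x + y) - (a *: S x + S y)) = 0) ->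
  (forall f, nrm f <= 1 -> nrm (S f) <= c) -> forall f, nrm (S f) <= c * nrm f.
Proof.
move=> lin bnd.
have S0 : nrm (S 0) = 0.
  have := lin 1 0 0; rewrite !scale1r addr0 opprD addrA subrr sub0r.
  by rewrite (nrmN dotP).
have SZ a x : nrm (S (a *: x)) = cmod a * nrm (S x).
  rewrite -(nrmZ dotP); apply: (nrm_null dotP).
  have := lin a x 0; rewrite addr0 => h.
  have -> : S (a *: x) - a *: S x = (S (a *: x) - (a *: S x + S 0)) + S 0.
    by rewrite opprD addrA subrK.
  apply/eqP; rewrite eq_le nrm_ge0 andbT.
  by rewrite (le_trans (nrmD dotP _ _))// h S0 addr0.
move=> f; have [f0|fn0] := eqVneq (nrm f) 0.
  rewrite f0 mulr0 real_leNgt ?num_real//; apply/negP => p0.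
  have c0 : 0 <= c by rewrite (le_trans _ (bnd 0 _)) ?nrm_ge0// (nrm0 dotP).
  have := bnd (((c + 1) / nrm (S f))%:C *: f).
  rewrite (nrmZ dotP) f0 mulr0 SZ cmodR ger0_norm ?divr_ge0 ?(ltW p0) ?addr_ge0//.
  by rewrite divfK ?gt_eqF// => /(_ ler01); lra.
have fp : 0 < nrm f by rewrite lt_neqAle eq_sym fn0 nrm_ge0.
have := bnd ((nrm f)^-1%:C *: f).
rewrite (nrmZ dotP) SZ cmodR ger0_norm ?invr_ge0 ?nrm_ge0// mulVf// lexx.
by move=> /(_ isT); rewrite mulrC ler_pdivrMr.
Qed.

Lemma L2norm_ge0 (f : R -> R[i]) : (0 <= L2norm f)%E.
Proof. exact: Lnorm_ge0. Qed.

Lemma opnorm_ge0 T : (0 <= opnorm T)%E.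
Proof.
apply: (le_trans (L2norm_ge0 (T (0 : V)))).
apply: ereal_sup_ubound; exists (0 : V) => //; split; first exact: (L2P (0 : V)).
by rewrite (L2norm_nrm (0 : V)) (nrm0 dotP) lee_fin.
Qed.

Lemma opnorm_bound T (hT : forall f, L2 f -> L2 (T f)) (c : R) :
  ae_linear T -> (opnorm T <= c%:E)%E -> forall f, nrm (lift hT f) <= c * nrm f.
Proof.
move=> lin Tc; apply: null_linear_bound; first exact: lift_linear.
move=> f f1; rewrite -lee_fin -L2norm_nrm (le_trans _ Tc)//.
apply: ereal_sup_ubound; exists (f : R -> R[i]) => //=; split; first exact: (L2P f).
by rewrite (L2norm_nrm f) lee_fin.
Qed.

Lemma bound_opnorm T (hT : forall f, L2 f -> L2 (T f)) (c : R) : 0 <= c ->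
  (forall f, nrm (lift hT f) <= c * nrm f) -> (opnorm T <= c%:E)%E.
Proof.
move=> c0 Tc; apply: ge_ereal_sup => _ [f /= [Lf f1] <-].
have := Tc (toL2 Lf); rewrite -lee_fin -L2norm_nrm => /le_trans -> //.
rewrite lee_fin ler_piMr//.
by rewrite -lee_fin -L2norm_nrm.
Qed.

Lemma ae_linearB T S : ae_linear T -> ae_linear S ->
  ae_linear (fun f x => T f x - S f x).
Proof.
move=> hT hS c f g Lf Lg.
apply: ae_imply (ae_and (hT c f g Lf Lg) (hS c f g Lf Lg)) => x [-> ->]; ring.
Qed.

Lemma L2B (f g : R -> R[i]) : L2 f -> L2 g -> L2 (fun x => f x - g x).
Proof.
move=> Lf Lg; have := L2P (toL2 Lf - toL2 Lg); congr L2.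
Qed.

Lemma singular_number_ge0 n T : (0 <= singular_number n T)%E.
Proof.
by apply: le_ereal_inf_tmp => _ [S _ <-]; exact: opnorm_ge0.
Qed.

Definition tensor_op (s : seq (V * V)) (f : R -> R[i]) (x : R) : R[i] :=
  \sum_(p <- s) cintegral (fun y => f y * (p.2 y)^*%C) * p.1 x.

Lemma tensor_opE s (f : V) x : tensor_op s f x = ftens dot s f x.
Proof. by rewrite L2val_sum. Qed.

Lemma tensor_op_L2 s f : L2 f -> L2 (tensor_op s f).
Proof.
move=> Lf; have := L2P (ftens dot s (toL2 Lf)); congr L2.
by apply/funext => x; rewrite -tensor_opE.
Qed.

Lemma ftens_linear (s : seq (V * V)) (a : R[i]) (f g : V) :
  ftens dot s (a *: f + g) = a *: ftens dot s f + ftens dot s g.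
Proof.
rewrite /ftens scaler_sumr -big_split; apply: eq_bigr => p _ /=.
by rewrite (dotDl dotP) (dotZl dotP) scalerDl scalerA.
Qed.

Lemma tensor_op_bounded s : bounded_operator (tensor_op s).
Proof.
split.
- by move=> f; exact: tensor_op_L2.
- move=> c f g Lf Lg; apply: ae_forall => x.
  have := tensor_opE s (c *: toL2 Lf + toL2 Lg) x.
  by rewrite ftens_linear L2valD L2valZ -!tensor_opE.
apply: (@le_lt_trans _ _ (\sum_(p <- s) nrm p.1 * nrm p.2)%:E); last exact: ltry.
apply: (bound_opnorm (hT := @tensor_op_L2 s)).
  by apply: sumr_ge0 => p _; rewrite mulr_ge0 ?nrm_ge0.
move=> f; have -> : lift (@tensor_op_L2 s) f = ftens dot s f.
  by apply: L2fun_ext => x; exact: tensor_opE.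
rewrite (le_trans (nrm_sum dotP _ _))// mulr_suml ler_sum// => p _.
rewrite (nrmZ dotP) (_ : _ * nrm f = (nrm f * nrm p.2) * nrm p.1); last by ring.
by rewrite ler_wpM2r ?nrm_ge0// (cauchy_schwarz dotP).
Qed.

Lemma tensor_op_rank s n : (size s <= n)%N -> rank_le n (tensor_op s).
Proof.
move=> sn; pose z : V * V := (0, 0).
exists (fun i : 'I_n => (nth z s i).1); split; first by move=> i; exact: L2P.
move=> f Lf; exists (fun i : 'I_n => dot (toL2 Lf) (nth z s i).2).
apply: ae_forall => x.
rewrite /tensor_op (big_nth z) big_mkord.
rewrite (big_ord_widen n (fun i => cintegral (fun y => f y * ((nth z s i).2 y)^*%C) *
  (nth z s i).1 x) sn) big_mkcond /=; apply: eq_bigr => i _.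
case: ifPn => //; rewrite -leqNgt => si; rewrite nth_default//=.
by rewrite [X in _ * X](_ : _ = 0)// mulr0.
Qed.

Lemma singular_number_le T (hT : forall f, L2 f -> L2 (T f)) (n : nat) (sg : R) :
  0 <= sg -> approx dot n sg (lift hT) -> (singular_number n T <= sg%:E)%E.
Proof.
move=> sg0 [s sn hs]; pose S := tensor_op s.
apply: (@le_trans _ _ (opnorm (fun f x => T f x - S f x))).
  apply: ereal_inf_lbound; exists S => //=; split; first exact: tensor_op_bounded.
  exact: tensor_op_rank.
have hTS f : L2 f -> L2 (fun x => T f x - S f x).
  by move=> Lf; apply: L2B; [exact: (hT f Lf)|exact: tensor_op_L2].
apply: (bound_opnorm (hT := hTS)) => // f.
have -> : lift hTS f = lift hT f - ftens dot s f; last exact: hs.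
by apply: L2fun_ext => x; rewrite L2valB -tensor_opE.
Qed.

Lemma singular_number_mono T m n : (m <= n)%N ->
  (singular_number n T <= singular_number m T)%E.
Proof.
move=> mn; apply: ereal_inf_le_tmp => _ [S [/= bS [g [Lg hg]]] <-].
exists S => //=; split => //.
exists (fun i : 'I_n => if insub (val i) is Some j then g j else fun=> 0); split.
  by move=> i; case: insubP => [j _ _|_]; [exact: Lg|exact: L20].
move=> f Lf; have [c hc] := hg f Lf.
exists (fun i : 'I_n => if insub (val i) is Some j then c j else 0).
apply: ae_imply hc => x ->.
pose F (i : nat) := (if (insub i : option 'I_m) is Some j then c j else 0) *
  (if (insub i : option 'I_m) is Some j then g j else fun=> 0) x.
rewrite (eq_bigr (fun i : 'I_m => F i)); last by move=> i _; rewrite /F valK.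
rewrite (big_ord_widen n F mn) big_mkcond /=; apply: eq_bigr => i _.
by rewrite /F; case: ifPn => // im; rewrite insubN// mul0r.
Qed.

Lemma singular_number_fin n T : bounded_operator T ->
  singular_number n T \is a fin_num.
Proof.
move=> [hT lin Ty]; rewrite ge0_fin_numE ?singular_number_ge0//.
rewrite (le_lt_trans _ Ty)//; apply: (@le_trans _ _ (singular_number 0 T)).
  exact: singular_number_mono.
have Tfin : opnorm T \is a fin_num by rewrite ge0_fin_numE ?opnorm_ge0.
rewrite -(fineK Tfin); apply: (singular_number_le (hT := hT)).
  by rewrite fine_ge0// opnorm_ge0.
by apply: approx0; apply: opnorm_bound => //; rewrite fineK.
Qed.

Lemma singular_number_approx n T (hT : forall f, L2 f -> L2 (T f)) (e : R) :
  0 < e -> bounded_operator T ->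
  exists2 S : V -> V, rank_lt dot n.+1 S &
    forall f, nrm (lift hT f - S f) <= (fine (singular_number n T) + e) * nrm f.
Proof.
move=> e0 bT; have fn := singular_number_fin n bT.
have [_ [S [bS [g [Lg hg]]] <-] hS] := lb_ereal_inf_adherent e0 fn.
case: bS => hS2 linS _.
exists (lift hS2).
  split; first exact: lift_linear.
  pose G i : V := if (insub i : option 'I_n) is Some j then toL2 (Lg j) else 0.
  exists (mkseq G n); first by rewrite size_mkseq.
  move=> f; have [c hc] := hg f (L2P f).
  exists (fun i => if (insub i : option 'I_n) is Some j then c j else 0).
  apply: nrm_ae0; apply: ae_imply hc => x hx.
  rewrite L2valB /= hx L2val_sum.
  apply/eqP; rewrite subr_eq0; apply/eqP; symmetry.
  pose H i := ((if (insub i : option 'I_n) is Some j then c j else 0) *: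
    (mkseq G n)`_i : V) x.
  rewrite -(big_mkord predT H) size_mkseq big_mkord; apply: eq_bigr => i _.
  by rewrite /H nth_mkseq// /G valK.
have hTS f : L2 f -> L2 (fun x => T f x - S f x).
  by move=> Lf; apply: L2B; [exact: (hT f Lf)|exact: (hS2 f Lf)].
move=> f; have -> : lift hT f - lift hS2 f = lift hTS f by exact: L2fun_ext.
apply: opnorm_bound; first by apply: ae_linearB => //; case: bT.
by rewrite EFinD fineK// ltW.
Qed.

End SingularNumbers.

(** * Kernel operators *)

Section KernelOperators.
Variable R : realType.
Local Notation mu := (@lebesgue_measure R).
Local Notation nrm := (nrm (@L2dot R)).
Local Notation dot := (@L2dot R).
Local Notation V := (L2fun R).
Let dotP := @L2dot_semi_inner R.

(** The integrals of the positive and of the negative part are both measurable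
    in x by Tonelli's theorem. *)
Lemma measurable_Rintegral (h : R * R -> R) : measurable_fun setT h ->
  measurable_fun setT (fun x => Rintegral mu setT (fun y => h (x, y))).
Proof.
move=> mh; apply: (@measurableT_comp _ _ _ _ _ _ fine _
  (fun x => (\int[mu]_y (h (x, y))%:E)%E)).
  exact: fine_measurable.
have mE : measurable_fun setT (fun z => (h z)%:E) by exact/measurable_EFinP.
under eq_fun do rewrite integralE.
have Fp := @measurable_fun_fubini_tonelli_F _ _ _ _ _ mu _
  (measurable_funepos mE) (funepos_ge0 _).
have Fn := @measurable_fun_fubini_tonelli_F _ _ _ _ _ mu _
  (measurable_funeneg mE) (funeneg_ge0 _).
apply: emeasurable_funB.
  by apply: eq_measurable_fun Fp => x _; apply: eq_integral => y _; rewrite !funeposE.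
by apply: eq_measurable_fun Fn => x _; apply: eq_integral => y _; rewrite !funenegE.
Qed.

Lemma cmeasurable_kernel_operator (k : R * R -> R[i]) (f : R -> R[i]) :
  cmeasurable k -> cmeasurable f -> cmeasurable (kernel_operator k f).
Proof.
move=> mk [f1 f2].
have mf : cmeasurable (fun z : R * R => f z.2).
  by split; [exact: (measurableT_comp f1 measurable_snd)|
             exact: (measurableT_comp f2 measurable_snd)].
have [m1 m2] := cmeasurableM mk mf.
by split; [exact: (measurable_Rintegral m1)|exact: (measurable_Rintegral m2)].
Qed.

Lemma cmeasurable_max (psi : R -> R[i]) : cmeasurable psi ->
  cmeasurable (fun z : R * R => psi (Num.max z.1 z.2)).
Proof.
have mm : measurable_fun setT (fun z : R * R => Num.max z.1 z.2).
  exact: (measurable_maxr measurable_fst measurable_snd).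
by move=> [p1 p2]; split; [exact: (measurableT_comp p1 mm)|
                           exact: (measurableT_comp p2 mm)].
Qed.

End KernelOperators.

Section MaxMultiplier.
Variables (R : realType) (p : R) (psi : R -> R[i]).
Local Notation mu := (@lebesgue_measure R).
Local Notation nrm := (nrm (@L2dot R)).
Local Notation dot := (@L2dot R).
Local Notation V := (L2fun R).
Let dotP := @L2dot_semi_inner R.
Hypotheses (p2 : 2^-1 < p) (bv : bounded_variation_line psi).

Variable k : R * R -> R[i].
Hypothesis hk : kernel_in_schatten p k.
Local Notation T := (kernel_operator k).
Local Notation wk := (fun z : R * R => psi (Num.max z.1 z.2) * k z).
Local Notation Tw := (kernel_operator wk).

Let mk : cmeasurable k. Proof. by case: hk. Qed.

Let kint (f : V) : {ae mu, forall x, cintegrable (fun y => k (x, y) * f y)}.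
Proof. by case: hk => _ h _; exact: h (L2P f). Qed.

Let bT : bounded_operator T. Proof. by case: hk => _ _ []. Qed.

Let hT : forall f, L2 f -> L2 (T f). Proof. by case: bT. Qed.

Let mpsi : cmeasurable psi.
Proof. by have [_] := bounded_variation_stepwise bv. Qed.

Let psi_bounded : exists B, forall x, cmod (psi x) <= B.
Proof.
have [[M sM] _] := bounded_variation_stepwise bv.
have [q [A [c [iA cM hA]]]] := sM 1 ltr01.
exists (1 + M) => x; rewrite -[psi x](subrK (step_symbol A c x)).
rewrite (le_trans (cmodD _ _))// lerD// (le_trans (cmod_sum _ _))//.
rewrite (le_trans _ cM)// ler_sum// => t _.
by rewrite cmodM ler_piMr ?cmod_ge0 ?cmod_cindic.
Qed.

Lemma cmeasurable_max_section (x : R) : cmeasurable (fun y : R => psi (Num.max x y)).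
Proof.
have [m1 m2] := cmeasurable_max mpsi.
by split; [exact: (measurableT_comp m1 (pair1_measurable x))|
           exact: (measurableT_comp m2 (pair1_measurable x))].
Qed.

Let wkint (f : R -> R[i]) (x : R) : cintegrable (fun y => k (x, y) * f y) ->
  cintegrable (fun y => wk (x, y) * f y).
Proof.
have [B hB] := psi_bounded => ik.
have := cintegrable_mul_bounded (cmeasurable_max_section x) (fun y => hB _) ik.
by congr cintegrable; apply/funext => y; rewrite mulrA.
Qed.

Lemma cmeasurable_weighted_kernel : cmeasurable wk.
Proof. exact: cmeasurableM (cmeasurable_max mpsi) mk. Qed.

(** Pointwise convergence of the step multipliers: at x the error is the sup
    distance of the symbols times the integral of |k(x, y) f(y)| over y. *)
Lemma step_multiplier_close (f : V) (x : R) : cintegrable (fun y => k (x, y) * f y) ->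
  exists2 B, 0 <= B & forall q (A : 'I_q -> set R) (c : 'I_q -> R[i])
    (iA : forall t, initial_segment (A t)) (e : R), 0 <= e ->
    (forall u, cmod (psi u - step_symbol A c u) <= e) ->
    cmod (chain_mult (step_proj iA) c (lift hT) f x - Tw f x) <= e * B.
Proof.
move=> ik; have [i1 i2] := ik.
pose b y := `|complex.Re (k (x, y) * f y)| + `|complex.Im (k (x, y) * f y)|.
have ib : mu.-integrable setT (fun y => (b y)%:E).
  under eq_fun do rewrite EFinD.
  by apply: integrableD => //; [exact: (integrable_norm i1)|exact: (integrable_norm i2)].
exists (2 * Rintegral mu setT b).
  by rewrite mulr_ge0// Rintegral_ge0// => y _; rewrite addr_ge0.
move=> q A c iA e e0 close.
rewrite (@chain_mult_kernel _ _ _ _ _ k)//.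
have mS : cmeasurable (fun y : R => step_symbol A c (Num.max x y)).
  have [m1 m2] := cmeasurable_max (cmeasurable_step_symbol c iA).
  by split; [exact: (measurableT_comp m1 (pair1_measurable x))|
             exact: (measurableT_comp m2 (pair1_measurable x))].
have mh : cmeasurable (fun y : R => k (x, y) * f y).
  by split; apply/measurable_EFinP; [case/integrableP: i1|case/integrableP: i2].
have iS : cintegrable (fun y => step_symbol A c (Num.max x y) * (k (x, y) * f y)).
  have [B hB] := psi_bounded.
  apply: (@cintegrable_mul_bounded _ _ _ (e + B)) => // y.
  rewrite -[step_symbol A c _](subrK (psi (Num.max x y))).
  by rewrite (le_trans (cmodD _ _))// lerD// -cmodN opprB.
have -> : cintegral (fun y => step_symbol A c (Num.max x y) * (k (x, y) * f y)) -
    Tw f x = cintegral (fun y =>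
      (step_symbol A c (Num.max x y) - psi (Num.max x y)) * (k (x, y) * f y)).
  rewrite -mulN1r /kernel_operator -cintegralZ; last exact: wkint.
  rewrite -cintegralD//; last by apply: cintegrableZ; exact: wkint.
  by apply: eq_cintegral => y; ring.
rewrite mulrCA -RintegralZl//.
apply: cmod_cintegral_le.
- exact: cmeasurableM (cmeasurableB mS (cmeasurable_max_section x)) mh.
- by under eq_fun do rewrite EFinM; exact: integrableZl.
move=> y; rewrite cmodM; apply: ler_pM; rewrite ?cmod_ge0//.
  by rewrite -cmodN opprB close.
exact: cmod_le_ReIm.
Qed.

Lemma vanishing_factor (B e : R) : 0 <= B -> 0 < e ->
  exists N, forall n, (N <= n)%N -> n.+1%:R^-1 * B <= e.
Proof.
move=> B0 e0; exists (Num.truncn (B / e)) => n Nn.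
rewrite mulrC ler_pdivrMr// mulrC -ler_pdivrMr// ltW//.
have /andP[_ h] := Num.Theory.truncn_itv (divr_ge0 B0 (ltW e0)).
by rewrite (lt_le_trans h)// ler_nat.
Qed.

(** A step function with its number of segments bundled, so that sequences of
    step functions can be chosen. *)
Record step_fun := StepFun {
  step_size : nat;
  step_sets : 'I_step_size -> set R;
  step_coef : 'I_step_size -> R[i];
  step_init : forall t, initial_segment (step_sets t) }.

Let sym (s : step_fun) := step_symbol (@step_sets s) (@step_coef s).
Let Om (s : step_fun) := chain_mult (step_proj (@step_init s)) (@step_coef s).

Lemma step_sequence : exists (M : R) (st : nat -> step_fun), 0 <= M /\
  forall j, \sum_t cmod (@step_coef (st j) t) <= M /\
    forall x, cmod (psi x - sym (st j) x) <= j.+1%:R^-1.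
Proof.
have [[M sM] _] := bounded_variation_stepwise bv.
have /choice[st hst] j : exists s : step_fun,
    \sum_t cmod (@step_coef s t) <= M /\
    forall x, cmod (psi x - sym s x) <= j.+1%:R^-1.
  have j0 : 0 < j.+1%:R^-1 :> R by rewrite invr_gt0.
  by have [q [A [c [iA cM hA]]]] := sM _ j0; exists (StepFun c iA).
exists M, st; split => //; rewrite (le_trans _ (hst 0%N).1)// sumr_ge0// => t _.
exact: cmod_ge0.
Qed.

Section Limit.
Variables (M : R) (st : nat -> step_fun).
Hypothesis M0 : 0 <= M.
Hypothesis stM : forall j, \sum_t cmod (@step_coef (st j) t) <= M.
Hypothesis st_close : forall j x, cmod (psi x - sym (st j) x) <= j.+1%:R^-1.

Let a : R := fine (opnorm T).

Let a0 : 0 <= a. Proof. by rewrite fine_ge0// opnorm_ge0. Qed.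

Let Ta f : nrm (lift hT f) <= a * nrm f.
Proof.
case: bT => _ lin Ty; apply: opnorm_bound => //.
by rewrite fineK// ge0_fin_numE ?opnorm_ge0.
Qed.

Lemma step_multiplier_cvg (f : V) : {ae mu, forall x, forall e, 0 < e ->
  exists N, forall n, (N <= n)%N -> cmod (Om (st n) (lift hT) f x - Tw f x) <= e}.
Proof.
apply: ae_imply (kint f) => x ik e e0.
have [B B0 hB] := step_multiplier_close ik.
have [N hN] := vanishing_factor B0 e0.
exists N => n Nn; rewrite (le_trans _ (hN n Nn))//.
by apply: hB; [rewrite invr_ge0|exact: st_close].
Qed.

Let mTw (f : V) : cmeasurable (Tw f).
Proof.
apply: cmeasurable_kernel_operator; first exact: cmeasurable_weighted_kernel.
exact: L2_cmeasurable (L2P f).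
Qed.

Lemma weighted_operator_bound (f : V) :
  L2 (Tw f) /\ (L2norm (Tw f) <= (M * a * nrm f)%:E)%E.
Proof.
apply: (L2_fatou _ (mTw f) (step_multiplier_cvg f)).
  by rewrite !mulr_ge0 ?nrm_ge0.
by move=> n; apply: (chain_mult_bound dotP (step_proj_chain (@step_init (st n)))).
Qed.

Lemma weighted_operator_L2 f : L2 f -> L2 (Tw f).
Proof. by move=> Lf; have [] := weighted_operator_bound (toL2 Lf). Qed.

Local Notation hTw := weighted_operator_L2.

Lemma weighted_operator_linear : ae_linear Tw.
Proof.
move=> c f g Lf Lg.
apply: ae_imply (ae_and (kint (toL2 Lf)) (kint (toL2 Lg))) => x [i1 i2].
rewrite /kernel_operator -cintegralZ; last exact: wkint.
rewrite -cintegralD; last exact: wkint.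
  by apply: eq_cintegral => y; ring.
by apply: cintegrableZ; exact: wkint.
Qed.

Lemma weighted_operator_bounded : bounded_operator Tw.
Proof.
split; [exact: hTw|exact: weighted_operator_linear|].
apply: (@le_lt_trans _ _ (M * a)%:E); last exact: ltry.
apply: (bound_opnorm (hT := hTw)); first by rewrite mulr_ge0.
move=> f; rewrite -lee_fin -L2norm_nrm.
by have [_] := weighted_operator_bound f.
Qed.

(** T is split into a finite rank part, on which the multiplier is controlled
    by the sup norm of the symbol, and a remainder of norm O(sg), on which it is
    controlled by M; so the step multipliers differ among themselves by O(sg)
    in norm, and Fatou's lemma carries this over to their limit. *)
Lemma step_multiplier_norm_close (n : nat) (S : V -> V) (sg : R) : 0 < sg ->
  rank_lt dot n S -> (forall f, nrm (lift hT f - S f) <= sg * nrm f) ->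
  exists N, forall f,
    nrm (lift hTw f - Om (st N) (lift hT) f) <= (4 * M + 1) * sg * nrm f.
Proof.
move=> sg0 rS TS.
have rZ : rank_lt dot 1 (fun _ : V => 0).
  split; first by move=> c x y; rewrite scaler0 addr0 subr0 (nrm0 dotP).
  by exists [::] => // f; exists (fun=> 0); rewrite big_ord0 subr0 (nrm0 dotP).
have as0 : 0 <= a + sg by rewrite addr_ge0// ltW.
have [|s [_ _ hs]] := difference_tensor dotP as0 sg0 rZ rS.
  move=> f; rewrite subr0 -[S f](subKr (lift hT f)) mulrDl.
  by rewrite (le_trans (nrmB dotP _ _))// lerD.
pose D := ftens dot s.
have TD f : nrm (lift hT f - D f) <= 2 * sg * nrm f.
  have -> : lift hT f - D f = (lift hT f - S f) + ((S f - 0) - D f).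
    by rewrite subr0 addrA subrK.
  by rewrite (le_trans (nrmD dotP _ _))// mulr_natl mulr2n mulrDl lerD.
pose C := \sum_(z <- s) nrm z.1 * nrm z.2.
have C0 : 0 <= C by apply: sumr_ge0 => z _; rewrite mulr_ge0 ?nrm_ge0.
have C20 : 0 <= 2 * C by rewrite mulr_ge0.
have [N hN] := vanishing_factor C20 sg0.
exists N => f.
pose F i := Om (st (N + i)%N) (lift hT) f - Om (st N) (lift hT) f.
have FC i : nrm (F i) <= (4 * M + 1) * sg * nrm f.
  have diff j : nrm (Om (st j) (lift hT) f - Om (st j) D f) <= M * (2 * sg) * nrm f.
    have PP := step_proj_chain (@step_init (st j)).
    rewrite -(chain_multB (@step_coef (st j)) PP).
    by apply: (chain_mult_bound dotP PP) => //; rewrite mulr_ge0// ltW.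
  have dD : nrm (Om (st (N + i)%N) D f - Om (st N) D f) <= sg * nrm f.
    have e0 : 0 <= 2 * N.+1%:R^-1 :> R by rewrite mulr_ge0 ?invr_ge0.
    apply: (@le_trans _ _ (C * (2 * N.+1%:R^-1) * nrm f)).
      apply: chain_mult_tensor_close => // x.
      rewrite -/(sym (st (N + i)%N) x) -/(sym (st N) x).
      have -> : sym (st (N + i)%N) x - sym (st N) x =
          (psi x - sym (st N) x) - (psi x - sym (st (N + i)%N) x) by ring.
      rewrite (le_trans (cmodD _ _))// cmodN mulr_natl mulr2n lerD//.
      rewrite (le_trans (st_close _ _))// lef_pV2 ?posrE// ler_nat ltnS.
      exact: leq_addr.
    rewrite ler_wpM2r ?nrm_ge0//.
    by rewrite mulrCA mulrA [_ * N.+1%:R^-1]mulrC hN.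
  have -> : F i = (Om (st (N + i)%N) (lift hT) f - Om (st (N + i)%N) D f) +
      (Om (st (N + i)%N) D f - Om (st N) D f) -
      (Om (st N) (lift hT) f - Om (st N) D f).
    by rewrite addrA subrK opprB addrA subrK.
  rewrite (le_trans (nrmB dotP _ _))// (le_trans (lerD (nrmD dotP _ _) (lexx _)))//.
  rewrite (le_trans (lerD (lerD (diff _) dD) (diff _)))//.
  by rewrite le_eqVlt; apply/orP; left; apply/eqP; ring.
have mh : cmeasurable (fun x => Tw f x - Om (st N) (lift hT) f x).
  exact: cmeasurableB (mTw f) (L2_cmeasurable (L2P _)).
have cvF : {ae mu, forall x, forall e, 0 < e -> exists N0, forall n0, (N0 <= n0)%N ->
    cmod (F n0 x - (Tw f x - Om (st N) (lift hT) f x)) <= e}.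
  apply: ae_imply (step_multiplier_cvg f) => x hx e e0.
  have [N1 hN1] := hx e e0; exists N1 => i Ni.
  rewrite L2valB (_ : _ - _ = Om (st (N + i)%N) (lift hT) f x - Tw f x); last by ring.
  by apply: hN1; rewrite (leq_trans Ni)// leq_addl.
have K0 : 0 <= (4 * M + 1) * sg * nrm f.
  by rewrite !mulr_ge0 ?nrm_ge0 ?(ltW sg0)// addr_ge0// mulr_ge0.
have [Lh hle] := L2_fatou K0 mh cvF FC.
rewrite -lee_fin -L2norm_nrm; apply: le_trans hle.
by rewrite le_eqVlt; apply/orP; left; apply/eqP.
Qed.

Lemma weighted_operator_schatten : schatten p Tw.
Proof.
split; first exact: weighted_operator_bounded.
have p0 : 0 < p by rewrite (lt_trans _ p2).
pose s n := fine (singular_number n T).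
pose t n := fine (singular_number n Tw).
have sE n : singular_number n T = (s n)%:E.
  by rewrite fineK//; exact: singular_number_fin bT.
have tE n : singular_number n Tw = (t n)%:E.
  by rewrite fineK//; exact: singular_number_fin weighted_operator_bounded.
have s0 n : 0 <= s n by rewrite fine_ge0// singular_number_ge0.
have t0 n : 0 <= t n by rewrite fine_ge0// singular_number_ge0.
have smono : {homo s : m n / (m <= n)%N >-> n <= m}.
  by move=> m n mn; rewrite -lee_fin -!sE singular_number_mono.
have tmono : {homo t : m n / (m <= n)%N >-> n <= m}.
  by move=> m n mn; rewrite -lee_fin -!tE singular_number_mono.
have [B sB] : exists B, forall N, \sum_(n < N) s n `^ p <= B.
  have [_ _ [_ sfin]] := hk.
  have h0 n : (0 <= poweR (singular_number n T) p)%E by exact: poweR_ge0.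
  exists (fine (\sum_(0 <= n <oo) poweR (singular_number n T) p)%E) => N.
  rewrite -lee_fin fineK; last first.
    by rewrite ge0_fin_numE//; apply: nneseries_ge0 => n _ _; exact: h0.
  have := @nneseries_lim_ge R (fun n => poweR (singular_number n T) p) xpredT 0 N
    (fun n _ _ => h0 n).
  apply: le_trans; rewrite -sumEFin big_mkord le_eqVlt; apply/orP; left; apply/eqP.
  by apply: eq_bigr => n _; rewrite sE poweR_EFin.
have [nu [d [nu0 nud transfer]]] := powR_summable_transfer p2.
pose sg m := s (2 ^ m).-1 + (4 ^+ m)^-1.
have sg0 m : 0 < sg m by rewrite ltr_wpDl// invr_gt0 exprn_gt0.
have sgS m : sg m.+1 <= sg m.
  rewrite lerD//.
    by apply: smono; have := expn_gt0 2 m; rewrite expnS; lia.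
  by rewrite lef_pV2 ?posrE ?exprn_gt0// exprS ler_peMl ?exprn_ge0// ler1n.
have /choice[S hS] m : exists S : V -> V, rank_lt dot (2 ^ m) S /\
    forall f, nrm (lift hT f - S f) <= sg m * nrm f.
  have e0 : 0 < (4 ^+ m)^-1 :> R by rewrite invr_gt0 exprn_gt0.
  have [S rS hS] := singular_number_approx (2 ^ m).-1 hT e0 bT.
  by exists S; split => //; move: rS; rewrite prednK ?expn_gt0.
have rS m := (hS m).1; have TS m := (hS m).2.
pose E m := sg m + \sum_(i < m) sg i / (nu (m - i)%N)%:R ^+ 2.
(* 2 M from the step multiplier of T and 4 M + 1 from its distance to the
   weighted operator *)
pose K := 6 * M + 1.
have K0 : 0 <= K by rewrite addr_ge0// mulr_ge0.
have E0 m : 0 <= E m.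
  rewrite addr_ge0 ?(ltW (sg0 m))// sumr_ge0// => i _.
  by rewrite divr_ge0 ?sqr_ge0// ltW.
have tK m : t (2 ^ (m + d))%N <= K * E m.
  have [N hN] := step_multiplier_norm_close (sg0 m) (rS m) (TS m).
  rewrite -lee_fin -tE; apply: (singular_number_le (hT := hTw)).
    by rewrite mulr_ge0.
  have h1 := approx_chain_mult dotP (step_proj_chain (@step_init (st N)))
    m (stM N) sg0 sgS rS TS nu0.
  have h2 : approx dot 0 ((4 * M + 1) * sg m)
      (fun f => lift hTw f - Om (st N) (lift hT) f) by exact: approx0.
  apply: (approx_eq dotP _ (approx_le _ _ (approxD dotP h1 h2))).
  - move=> f; rewrite (_ : _ - _ = 0) ?(nrm0 dotP)//.
    by apply/eqP; rewrite subr_eq0 addrC subrK.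
  - by rewrite addn0.
  have : sg m <= E m.
    rewrite lerDl sumr_ge0// => i _.
    by rewrite divr_ge0 ?sqr_ge0// ltW.
  rewrite -/(E m) /K => h; have := ler_wpM2l M0 h; move: h; lra.
have [B' tB] := transfer K B s t K0 s0 smono t0 tmono sB tK.
apply: (@le_lt_trans _ _ B'%:E); last exact: ltry.
apply: lime_le.
  by apply: is_cvg_nneseries => n _ _; exact: poweR_ge0.
apply: nearW => n; apply: le_trans (_ : (_ <= (\sum_(i < n) t i `^ p)%:E)%E) _.
  rewrite -sumEFin big_mkord le_eqVlt; apply/orP; left; apply/eqP.
  by apply: eq_bigr => i _; rewrite tE poweR_EFin.
rewrite lee_fin; exact: tB.
Qed.

End Limit.

Lemma max_kernel_in_schatten : kernel_in_schatten p wk.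
Proof.
have [M [st [M0 hst]]] := step_sequence.
split; first exact: cmeasurable_weighted_kernel.
  by move=> f Lf; apply: ae_imply (kint (toL2 Lf)) => x; exact: wkint.
apply: (weighted_operator_schatten M0) => j; first exact: (hst j).1.
exact: (hst j).2.
Qed.

End MaxMultiplier.

Theorem theorem7p3 (R : realType) (p : R) (psi : R -> R[i]) :
  2^-1 < p -> bounded_variation_line psi ->
  schur_multiplier p (fun z : R * R => psi (Num.max z.1 z.2)).
Proof.
move=> p2 bv; rewrite /schur_multiplier; case: ifPn => [_|].
  by move=> k hk; exact: max_kernel_in_schatten.
rewrite -ltNge => pgt2 k hk; apply: max_kernel_in_schatten => //.
have p1 : 0 < p - 1 by lra.
rewrite ltr_pdivlMr//; lra.
Qed.
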